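(* Let $M$ be a matroid on $[n]$, $\mathcal{C}_L$ a linear class of circuits of $M$, and $\mathbf{K}$ a field. For each $h\ge 0$, the set of linear forms $\{\mathfrak{p}_I: I\in\operatorname{NBC}_{\mathcal{C}_L},|I|=h\}$ on $\operatorname{Z}(M,\mathcal{C}_L)_h$ is the dual basis of the basis $\{e_J: J\in\operatorname{NBC}_{\mathcal{C}_L},|J|=h\}$ of $\operatorname{Z}(M,\mathcal{C}_L)_h$; that is, $\mathfrak{p}_I(e_J)=\delta_{IJ}$ for all $I,J\in\operatorname{NBC}_{\mathcal{C}_L}$ with $|I|=|J|$. Consequently $\{\mathfrak{p}_I: I\in\operatorname{NBC}_{\mathcal{C}_L}\}$ is the dual basis of $\mathbf{nbc}_{\mathcal{C}_L}=\{e_I: I\in\operatorname{NBC}_{\mathcal{C}_L}\}$.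
   Context: Linear class: $\mathcal{C}_L\subseteq\mathcal{C}(M)$ such that whenever $C_1,C_2\in\mathcal{C}_L$ satisfy $\operatorname{r}(C_1)+\operatorname{r}(C_2)=\operatorname{r}(C_1\cup C_2)+\operatorname{r}(C_1\cap C_2)$, every circuit of $M$ in $C_1\cup C_2$ is in $\mathcal{C}_L$. For a non-loop $x$, $\mathcal{C}_L/x=\{C\setminus x: x\in C\in\mathcal{C}_L\}\cup\{C\in\mathcal{C}_L:x\notin\operatorname{cl}_M(C)\}$, a linear class of $M/x$. For a matroid $M$ on a linearly ordered finite set $S$ with linear class $\mathcal{C}_L$: $e_X=e_{i_1}\wedge\dots\wedge e_{i_m}$ for $X=\{i_1<\dots<i_m\}$, $e_\emptyset=1$, $\partial e_X=\sum_j(-1)^je_{X\setminus i_j}$, $\partial e_\emptyset=0$; $\operatorname{OS}(N)$ is the exterior algebra on the elements of $N$ modulo the ideal generated by $\partial e_C$ ($C$ circuit, $|C|>1$) and $e_C$ ($C$ circuit); the extended lift $N$ on $S\cup\{p\}$ is the dual of the single-element extension $N^\star$ of $M^\star$ with $p\in\operatorname{cl}_{N^\star}(H)$ iff $S\setminus H\in\mathcal{C}_L$ for each hyperplane $H$ of $M^\star$; the bias algebra is $\operatorname{Z}(M,\mathcal{C}_L)=\operatorname{OS}(N)/\langle e_p\rangle$, graded by degree, and $\operatorname{Z}(M,\mathcal{C}_L)_h$ is the subspace spanned by $e_X$ with $X$ independent, $|X|=h$. For a non-loop $x$, $\mathfrak{p}_x:\operatorname{Z}(M,\mathcal{C}_L)\to\operatorname{Z}(M/x,\mathcal{C}_L/x)$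 is the linear map with $\mathfrak{p}_xe_I=e_{I\setminus x}$ if $x\in I$, $\mathfrak{p}_xe_I=\pm e_{I\setminus y}$ if some $y\in I$ has $\{x,y\}\in\mathcal{C}_L$ (sign of the permutation replacing $y$ by $x$ in $I$), and $0$ otherwise. For an independent set $I=\{i_1<\dots<i_h\}$ of $M$, $\mathfrak{p}_I:=\mathfrak{p}_{i_1}\circ\mathfrak{p}_{i_2}\circ\dots\circ\mathfrak{p}_{i_h}$ (each $\mathfrak{p}_{i_t}$ taken for the successively contracted pair $(M/\{i_{t+1},\dots,i_h\},\cdot)$), restricted to $\operatorname{Z}(M,\mathcal{C}_L)_h$; it is a linear form with values in $\mathbf{K}$. For $C\in\mathcal{C}_L$ with $|C|>1$, $C\setminus\min C$ is a $\mathcal{C}_L$-broken circuit, and $\operatorname{NBC}_{\mathcal{C}_L}$ is the family of independent sets of $M$ containing no $\mathcal{C}_L$-broken circuit.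
   Formalization: The rules for p_x carry an extra sign, (-1)^(number of elements after x), i.e. e_I is read with x last; without it p_x is ill-defined for U_{2,3}, char K not 2. Also p is taken not to be a coloop of N*, which fixes the extension when C_L is empty. *)

(* Defs.v *)
From HB Require Import structures.
From mathcomp Require Import all_boot all_order all_algebra all_field.
From mathcomp Require Import zify.
From Stdlib Require Import ClassicalEpsilon.

Set Implicit Arguments.
Unset Strict Implicit.
Unset Printing Implicit Defensive.

Import GRing.Theory.

(* Finite matroids.  The ground set is a subset of a fixed type T, so that M and
   its contractions are matroids over the same type. *)

Section Matroid.
Variable T : finType.
Implicit Types (G A : {set T}) (F : {set {set T}}).

Definition matroid_axioms (d : {set T} * {set {set T}}) : bool :=
  let: (G, F) := d in
  [&& [forall I in F, I \subset G],
      set0 \in F,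
      [forall I in F, forall J : {set T}, (J \subset I) ==> (J \in F)] &
      [forall I in F, forall J in F, (#|I| < #|J|) ==>
         [exists x in J :\: I, x |: I \in F]]].

Record matroid := Matroid {
  matroid_val :> {set T} * {set {set T}};
  _ : matroid_axioms matroid_val }.

HB.instance Definition _ := [isSub for matroid_val].
HB.instance Definition _ := [Finite of matroid by <:].

Implicit Types M : matroid.

Definition ground M : {set T} := M.1.
Definition indep M : {set {set T}} := M.2.

Lemma matroid_axiomsP G F :
  [/\ forall I, I \in F -> I \subset G,
      set0 \in F,
      forall I J : {set T}, I \in F -> J \subset I -> J \in F &
      forall I J : {set T}, I \in F -> J \in F -> #|I| < #|J| ->
        exists2 x, x \in J :\: I & x |: I \in F]
  <-> matroid_axioms (G, F).
Proof.
split=> [[h1 h2 h3 h4]|/and4P[h1 h2 h3 h4]].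
  apply/and4P; split=> //.
  - by apply/forall_inP.
  - by apply/forall_inP=> I FI; apply/forallP=> J; apply/implyP; apply: h3.
  - apply/forall_inP=> I FI; apply/forall_inP=> J FJ; apply/implyP=> lt.
    by have [x xJ xI] := h4 I J FI FJ lt; apply/exists_inP; exists x.
split=> //.
- by apply/forall_inP.
- by move=> I J FI sJ; move/forall_inP/(_ I FI)/forallP/(_ J)/implyP: h3; apply.
- move=> I J FI FJ lt; move/forall_inP/(_ I FI)/forall_inP/(_ J FJ): h4.
  by rewrite lt /= => /exists_inP.
Qed.

Lemma matroidP M :
  [/\ forall I, I \in indep M -> I \subset ground M,
      set0 \in indep M,
      forall I J : {set T}, I \in indep M -> J \subset I -> J \in indep M &
      forall I J : {set T}, I \in indep M -> J \in indep M -> #|I| < #|J| ->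
        exists2 x, x \in J :\: I & x |: I \in indep M].
Proof. by apply/matroid_axiomsP; case: M => -[]. Qed.

Definition circuits M : {set {set T}} :=
  [set C : {set T} | [&& C \subset ground M, C \notin indep M &
                        [forall x in C, C :\ x \in indep M]]].

Definition rk M A : nat := \max_(I in indep M | I \subset A) #|I|.

Definition closure M A : {set T} :=
  [set x in ground M | rk M (x |: A) == rk M A].

Definition hyperplanes M : {set {set T}} :=
  [set H : {set T} | [&& H \subset ground M, closure M H == H &
                        (rk M H).+1 == rk M (ground M)]].

Definition bases M : {set {set T}} :=
  [set B in indep M | [forall I in indep M, #|I| <= #|B|]].

Lemma indep_extend M I A B :
  I \in indep M -> I \subset A -> B \in bases M -> B \subset A ->
  exists B', [/\ B' \in bases M, I \subset B' & B' \subset A].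
Proof.
have [_ _ _ aug] := matroidP M.
move=> + + /[!inE]/andP[iB /forall_inP Bmax] sB.
have [k] := ubnP (#|B| - #|I|); elim: k I => // k IHk I ltk iI sI.
case: (ltnP #|I| #|B|) => [ltIB|leBI].
  have [x /setDP[xB xI] ixI] := aug _ _ iI iB ltIB.
  have [||B' [bB' sIB' sB']] := IHk (x |: I) _ ixI.
  - rewrite cardsU1 xI; apply: leq_trans (_ : #|B| - #|I| <= _); last by rewrite -ltnS.
    by rewrite ltn_sub2l.
  - by rewrite subUset sub1set (subsetP sB).
  by exists B'; split=> //; apply: subset_trans sIB'; apply: subsetUr.
exists I; split=> //; rewrite inE iI; apply/forall_inP=> J iJ.
exact: leq_trans (Bmax J iJ) leBI.
Qed.

Lemma bases_card M B B' : B \in bases M -> B' \in bases M -> #|B| = #|B'|.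
Proof.
rewrite !inE => /andP[iB /forall_inP mB] /andP[iB' /forall_inP mB'].
by apply/eqP; rewrite eqn_leq mB' ?mB.
Qed.

Lemma indep_base M I : I \in indep M -> exists2 B, B \in bases M & I \subset B.
Proof.
move=> iI; have [B iB Bmax] := @arg_maxnP _ I (mem (indep M)) (fun A => #|A|) iI.
have bB : B \in bases M by rewrite inE (iB : B \in indep M); apply/forall_inP.
have [B' [bB' sI _]] := indep_extend iI (subsetT I) bB (subsetT B).
by exists B'.
Qed.

Definition dual_indep M : {set {set T}} :=
  [set X : {set T} | (X \subset ground M) &&
                     [exists B in bases M, [disjoint X & B]]].

Fact dual_axioms M : matroid_axioms (ground M, dual_indep M).
Proof.
have [sub i0 her aug] := matroidP M.
apply/matroid_axiomsP; split.
- by move=> I /[!inE]/andP[].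
- have [B bB _] := indep_base i0; rewrite inE sub0set /=.
  by apply/exists_inP; exists B; rewrite // disjoint_sym disjoints_subset setC0 subsetT.
- move=> I J /[!inE]/andP[sI /exists_inP[B bB dB]] sJ.
  rewrite (subset_trans sJ sI); apply/exists_inP; exists B => //.
  exact: disjointWl dB.
move=> X Y /[!inE]/andP[sX /exists_inP[B bB dXB]] /andP[sY /exists_inP[D bD dYD]] ltXY.
have iD : D \in indep M by move: bD; rewrite inE => /andP[].
have sDX : D :\: X \subset ~: X by rewrite setDE subsetIr.
have sBX : B \subset ~: X by rewrite -disjoints_subset disjoint_sym.
have [E [bE sDE sEX]] := indep_extend (her _ _ iD (subsetDl D X)) sDX bB sBX.
have [YE|] := boolP (Y :\: X \subset E).
  have le1 : #|D :\: X| + #|Y :\: X| <= #|D|.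
    rewrite (bases_card bD bE) -cardsUI (_ : _ :&: _ = set0) ?cards0 ?addn0.
      by rewrite subset_leq_card // subUset sDE.
    apply/eqP; rewrite setI_eq0; apply: disjointWl (subsetDl _ _) _.
    by apply: disjointWr (subsetDl _ _) _; rewrite disjoint_sym.
  have le2 : #|D :&: X| + #|Y :&: X| <= #|X|.
    rewrite -cardsUI (_ : _ :&: _ :&: _ = set0) ?cards0 ?addn0.
      by rewrite subset_leq_card // subUset !subsetIr.
    apply/eqP; rewrite setI_eq0; apply: disjointWl (subsetIl _ _) _.
    by apply: disjointWr (subsetIl _ _) _; rewrite disjoint_sym.
  by have := cardsID X D; have := cardsID X Y; lia.
case/subsetPn=> y yYX yE; exists y => //; rewrite inE.
rewrite subUset sub1set (subsetP sY) ?sX; last by case/setDP: yYX.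
apply/exists_inP; exists E; rewrite // disjoint_sym disjoints_subset.
apply/subsetP=> z zE; rewrite !inE negb_or (contraTneq _ zE); last by move=> ->.
by have := subsetP sEX z zE; rewrite inE.
Qed.

Definition dual M : matroid := Matroid (dual_axioms M).

Definition contract_indep M (x : T) : {set {set T}} :=
  if [set x] \in indep M then
    [set I : {set T} | (x \notin I) && (x |: I \in indep M)]
  else indep M.

Fact contract_axioms M x : matroid_axioms (ground M :\ x, contract_indep M x).
Proof.
have [sub i0 her aug] := matroidP M.
rewrite /contract_indep; case: ifPn => ix; apply/matroid_axiomsP; split.
- move=> I /[!inE]/andP[xI /sub sI]; rewrite subsetD1 xI andbT.
  exact: subset_trans (subsetUr _ _) sI.
- by rewrite !inE setU0.
- move=> I J /[!inE]/andP[xI iI] sJ; rewrite (contra (subsetP sJ x) xI) /=.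
  by apply: her iI _; apply: setUS.
- move=> I J /[!inE]/andP[xI iI] /andP[xJ iJ] lt.
  have [|y] := aug _ _ iI iJ; first by rewrite !cardsU1 xI xJ.
  rewrite !inE negb_or => /andP[/andP[yx yI]]; rewrite (negPf yx) /= => yJ iy.
  by exists y; rewrite !inE ?yI // negb_or eq_sym yx xI setUCA.
- move=> I iI; rewrite subsetD1 sub //=; apply: contra ix => xI.
  by apply: her iI _; rewrite sub1set.
- by [].
- exact: her.
- exact: aug.
Qed.

(* For a loop x this is the deletion of x. *)
Definition contract M x : matroid := Matroid (contract_axioms M x).

Fact empty_axioms : matroid_axioms (set0 : {set T}, [set set0 : {set T}]).
Proof.
apply/matroid_axiomsP; split.
- by move=> I /set1P->.
- by rewrite inE.
- by move=> I J /set1P->; rewrite subset0 inE.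
- by move=> I J /set1P-> /set1P->; rewrite ltnn.
Qed.

Definition empty_matroid : matroid := Matroid empty_axioms.

Definition linear_class M (CL : {set {set T}}) : Prop :=
  CL \subset circuits M /\
  (forall C1 C2 C, C1 \in CL -> C2 \in CL ->
     rk M C1 + rk M C2 = rk M (C1 :|: C2) + rk M (C1 :&: C2) ->
     C \in circuits M -> C \subset C1 :|: C2 -> C \in CL).

Definition contract_class M (CL : {set {set T}}) (x : T) : {set {set T}} :=
  [set C :\ x | C in [set C in CL | x \in C]] :|:
  [set C in CL | x \notin closure M C].

End Matroid.

(* The extended lift.  A matroid M over 'I_n is lifted to a matroid over
   'I_n.+1, the new element p being ord_max. *)

Section Lift.
Variable n : nat.
Implicit Types (M : matroid 'I_n) (CL : {set {set 'I_n}}) (X : {set 'I_n}).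

Definition emb X : {set 'I_n.+1} := [set lift ord_max i | i in X].

Definition new_point : 'I_n.+1 := ord_max.

(* N is the single-element extension of M whose linear subclass is the set of
   hyperplanes H with S \ H in CL.  The clause p \in closure N S (p is not a
   coloop of N) only matters when no hyperplane is selected: the conditions on
   hyperplanes alone do not then tell a free extension from a coloop. *)
Definition is_extension M CL (N : matroid 'I_n.+1) : bool :=
  [&& ground N == new_point |: emb (ground M),
      [forall X, (emb X \in indep N) == (X \in indep M)],
      new_point \in closure N (emb (ground M)) &
      [forall H in hyperplanes M,
         (new_point \in closure N (emb H)) == (ground M :\: H \in CL)]].

(* By Crapo's theorem the extension exists and is unique when CL is a linear
   class of M; the value in all other cases is irrelevant. *)
Definition extended_lift M CL : matroid 'I_n.+1 :=
  dual (odflt (empty_matroid _) [pick N | is_extension (dual M) CL N]).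

End Lift.

(* The exterior algebra over K on generators e_0, ..., e_(m-1): an element is
   the family of its coordinates in the basis (e_X), X ranging over the subsets
   of 'I_m. *)

Local Open Scope ring_scope.

Definition exterior (K : fieldType) (m : nat) := {ffun {set 'I_m} -> K^o}.

HB.instance Definition _ (K : fieldType) (m : nat) :=
  Vector.copy (exterior K m) {ffun {set 'I_m} -> K^o}.

Section Exterior.
Variables (K : fieldType) (m : nat).
Implicit Types (u v w : exterior K m) (A B C Z : {set 'I_m}).

(* For A, B disjoint, (-1) ^+ inv A B is the sign of the permutation sorting
   the word formed by A followed by B. *)
Definition inv A B : nat := \sum_(a in A) #|[set b in B | (b < a)%N]|.

Definition ext_mul u v : exterior K m :=
  [ffun Z : {set 'I_m} => \sum_(A : {set 'I_m} | A \subset Z)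
               (-1) ^+ inv A (Z :\: A) * (u A * v (Z :\: A))].

Definition ext_e A : exterior K m := [ffun Z : {set 'I_m} => (Z == A)%:R].

Lemma inv0s A : inv set0 A = 0%N.
Proof. by rewrite /inv big_set0. Qed.

Lemma invs0 A : inv A set0 = 0%N.
Proof. by rewrite /inv big1 // => a _; apply: eq_card0 => b; rewrite !inE. Qed.

Lemma invUl A B C : [disjoint A & B] -> inv (A :|: B) C = (inv A C + inv B C)%N.
Proof. by move=> dAB; rewrite /inv -bigU //; apply: eq_bigl => a; rewrite !inE. Qed.

Lemma invUr A B C : [disjoint B & C] -> inv A (B :|: C) = (inv A B + inv A C)%N.
Proof.
move=> dBC; rewrite /inv -big_split; apply: eq_bigr => a _ /=.
rewrite (_ : [set b in B :|: C | _] =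
   [set b in B | (b < a)%N] :|: [set b in C | (b < a)%N]); last first.
  by apply/setP=> b; rewrite !inE andb_orl.
rewrite -cardsUI [in RHS](_ : _ :&: _ = set0) ?cards0 ?addn0 //.
apply/setP=> b; rewrite !inE; apply/negbTE/negP=> /andP[/andP[bB _] /andP[bC _]].
by move: (disjointFr dBC bB); rewrite bC.
Qed.

Lemma inv_assoc A (D : {set 'I_m}) Z : A \subset D -> D \subset Z ->
  (inv A (Z :\: A) + inv (D :\: A) (Z :\: D) =
   inv A (D :\: A) + inv D (Z :\: D))%N.
Proof.
move=> sAD sDZ.
have -> : Z :\: A = (D :\: A) :|: (Z :\: D).
  apply/setP=> x; rewrite !inE; have := subsetP sAD x; have := subsetP sDZ x.
  by case: (x \in A) (x \in D) (x \in Z) => [] [] [] //= => [_ /(_ isT)|/(_ isT)].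
have eD : inv D (Z :\: D) = inv (A :|: (D :\: A)) (Z :\: D).
  by rewrite -{1}(setID D A) (setIidPr sAD).
rewrite eD invUl ?invUr ?addnA //; rewrite disjoints_subset; apply/subsetP=> x;
  by rewrite !inE; case: (x \in A) (x \in D) => [] [].
Qed.

Lemma ext_mulA : associative ext_mul.
Proof.
move=> u v w; apply/ffunP=> Z; rewrite !ffunE.
pose F (A D : {set 'I_m}) : K := (-1) ^+ (inv A (D :\: A) + inv D (Z :\: D)) *
                  (u A * v (D :\: A) * w (Z :\: D)).
transitivity (\sum_(A : {set 'I_m} | A \subset Z)
   \sum_(D : {set 'I_m} | (D \subset Z) && (A \subset D)) F A D).
  apply: eq_bigr => A sA; rewrite ffunE !mulr_sumr.
  rewrite (reindex_onto (fun D => D :\: A) (fun B => B :|: A)) /=; last first.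
    by move=> B; rewrite subsetD setDUl setDv setU0 => /andP[_ /setDidPl].
  apply: eq_big => [D|D /andP[sD /eqP eD]].
    apply/andP/andP=> [[sD /eqP eD]|[sD sAD]].
      by split; rewrite -eD ?subsetUr // subUset sA (subset_trans sD) ?subsetDl.
    by rewrite setSD // setUC -{1}(setIidPr sAD) setID.
  have sAD : A \subset D by rewrite -eD subsetUr.
  have sDZ : D \subset Z.
    by rewrite -eD subUset sA (subset_trans sD) ?subsetDl.
  have eZ : Z :\: A :\: (D :\: A) = Z :\: D.
    by rewrite setDDl -{1}(setIidPr sAD) setID.
  rewrite eZ /F -inv_assoc // exprD !mulrA; congr (_ * _).
  by rewrite -!mulrA; congr (_ * _); rewrite mulrCA.
rewrite (exchange_big_dep (fun D : {set 'I_m} => D \subset Z)) /=; last first.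
  by move=> A D _ /andP[].
apply: eq_bigr => D sD; rewrite ffunE mulr_suml mulr_sumr.
apply: eq_big => [A|A /andP[_ /andP[_ sA]]].
  by rewrite sD /=; apply: andb_idl => /subset_trans; apply.
by rewrite /F exprD; rewrite -!mulrA mulrCA.
Qed.

Lemma ext_mul1e : left_id (ext_e set0) ext_mul.
Proof.
move=> u; apply/ffunP=> Z; rewrite ffunE (bigD1 (set0 : {set 'I_m})) ?sub0set //= big1 => [|A].
  by rewrite setD0 inv0s ffunE eqxx !mul1r addr0.
by move=> /andP[_ /negPf nA]; rewrite ffunE nA mulr0n mul0r mulr0.
Qed.

Lemma ext_mule1 : right_id (ext_e set0) ext_mul.
Proof.
move=> u; apply/ffunP=> Z; rewrite ffunE (bigD1 Z) //= big1 => [|A].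
  by rewrite setDv invs0 ffunE eqxx mul1r mulr1 addr0.
move=> /andP[sA nA]; rewrite ffunE setD_eq0.
case: (boolP (Z \subset A)) => sZ; last by rewrite mulr0n !mulr0.
by rewrite eqEsubset sA sZ in nA.
Qed.

Lemma ext_mulDl : left_distributive ext_mul +%R.
Proof.
move=> u v w; apply/ffunP=> Z; rewrite !ffunE -big_split; apply: eq_bigr => A _.
by rewrite ffunE mulrDl mulrDr.
Qed.

Lemma ext_mulDr : right_distributive ext_mul +%R.
Proof.
move=> u v w; apply/ffunP=> Z; rewrite !ffunE -big_split; apply: eq_bigr => A _.
by rewrite ffunE !mulrDr.
Qed.

Lemma ext_e_neq0 A : ext_e A != 0.
Proof.
by apply/eqP=> /ffunP/(_ A)/eqP; rewrite !ffunE eqxx oner_eq0.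
Qed.

HB.instance Definition _ := GRing.Zmodule_isNzRing.Build (exterior K m)
  ext_mulA ext_mul1e ext_mule1 ext_mulDl ext_mulDr (ext_e_neq0 set0).

Lemma ext_scaleAl (a : K) u v : a *: (u * v) = (a *: u) * v.
Proof.
apply/ffunP=> Z; rewrite !ffunE scaler_sumr; apply: eq_bigr => A _.
by rewrite !ffunE /GRing.scale /= -mulrA mulrCA.
Qed.

HB.instance Definition _ :=
  GRing.Lmodule_isLalgebra.Build K (exterior K m) ext_scaleAl.

Lemma ext_scaleAr (a : K) u v : a *: (u * v) = u * (a *: v).
Proof.
apply/ffunP=> Z; rewrite !ffunE scaler_sumr; apply: eq_bigr => A _.
by rewrite !ffunE /GRing.scale /= mulrCA; congr (_ * _); rewrite mulrCA.
Qed.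

HB.instance Definition _ :=
  GRing.Lalgebra_isAlgebra.Build K (exterior K m) ext_scaleAr.
HB.instance Definition _ := Algebra_isFalgebra.Build K (exterior K m).

Lemma ext_eM A B : ext_e A * ext_e B =
  if [disjoint A & B] then (-1) ^+ inv A B *: ext_e (A :|: B) else 0.
Proof.
apply/ffunP=> Z; rewrite ffunE.
have z X : X != A -> (-1) ^+ inv X (Z :\: X) * (ext_e A X * ext_e B (Z :\: X)) = 0.
  by move=> /negPf nX; rewrite ffunE nX mulr0n mul0r mulr0.
case: (boolP (A \subset Z)) => sA; last first.
  rewrite big1 => [|X sX]; last by apply: z; apply: contraNneq sA => <-.
  case: ifP => _; rewrite !ffunE //; case: eqP => [eZ|_]; last by rewrite scaler0.
  by rewrite eZ subsetUl in sA.
rewrite (bigD1 A) //= big1 ?addr0 => [|X /andP[_]]; last exact: z.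
rewrite !ffunE eqxx mul1r; case: ifP => dAB; rewrite !ffunE.
  case: (eqVneq Z (A :|: B)) => [->|nZ].
    have -> : (A :|: B) :\: A = B.
      by rewrite setDUl setDv set0U; apply/setDidPl; rewrite disjoint_sym.
    by rewrite eqxx.
  rewrite (_ : _ == B = false) ?mulr0 ?scaler0 //; apply: contraNF nZ => /eqP <-.
  by rewrite -{1}(setID Z A) (setIidPr sA).
rewrite (_ : _ == B = false) ?mulr0 //; apply: contraFF dAB => /eqP <-.
by rewrite disjoint_sym disjoints_subset setDE subsetIr.
Qed.

(* e_X = e_(i_1) /\ ... /\ e_(i_k) for X = {i_1 < ... < i_k}. *)
Lemma ext_eE A : ext_e A = \prod_(i <- enum A) ext_e [set i].
Proof.
have : sorted (fun i j : 'I_m => (i < j)%N) (enum A).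
  rewrite /enum_mem -enumT sorted_filter; first by [].
    by move=> j i k; apply: ltn_trans.
  by have := iota_ltn_sorted 0 m; rewrite -val_enum_ord sorted_map.
rewrite -{2}[A]set_enum; elim: (enum A) => [_|i s IHs].
  by rewrite big_nil; congr ext_e; apply/setP=> x; rewrite !inE.
rewrite /= path_sortedE => [/andP[/allP lts /IHs]|j k l]; last exact: ltn_trans.
rewrite big_cons => <-; rewrite ext_eM.
rewrite disjoints1 inE; case: ifPn => [|/negPn/lts]; last by rewrite ltnn.
move=> nis; rewrite /inv big_set1 (_ : [set _ in _ | _] = set0) ?cards0 ?expr0 ?scale1r.
  by congr ext_e; apply/setP=> x; rewrite !inE.
by apply/setP=> x; rewrite !inE; apply/negbTE/negP=> /andP[/lts/ltnW]; rewrite leqNgt => /negP.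
Qed.

End Exterior.

(* For V a subspace of U, the quotient U / V is modelled by the complement
   (U :\: V) of V in U; quot_class is the canonical projection of U, whose
   kernel in U is V. *)

Definition quot (K : fieldType) (vT : vectType K) (U V : {vspace vT}) : vectType K :=
  subvs_of (U :\: V)%VS.

Definition quot_class (K : fieldType) (vT : vectType K) (U V : {vspace vT})
  (u : vT) : quot U V := vsproj (U :\: V)%VS (addv_pi1 U V u).

Section OrlikSolomon.
Variables (K : fieldType) (m : nat).
Implicit Types (G X C : {set 'I_m}) (N : matroid 'I_m).

Definition boundary X : exterior K m :=
  \sum_(x in X) (-1) ^+ #|[set i in X | (i <= x)%N]| *: ext_e K (X :\ x).

Definition ext_on G : {vspace exterior K m} :=
  <<[seq ext_e K X | X <- enum (powerset G)]>>%VS.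

Definition gen_ideal G (s : seq (exterior K m)) : {vspace exterior K m} :=
  (ext_on G * <<s>> * ext_on G)%VS.

Definition os_gens N : seq (exterior K m) :=
  [seq boundary C | C <- enum [set C in circuits N | (1 < #|C|)%N]] ++
  [seq ext_e K C | C <- enum (circuits N)].

Definition OS N : vectType K :=
  quot (ext_on (ground N)) (gen_ideal (ground N) (os_gens N)).

End OrlikSolomon.

Section Bias.
Variables (K : fieldType) (n : nat).
Implicit Types (M : matroid 'I_n) (CL : {set {set 'I_n}}) (I X : {set 'I_n}).

(* OS(N) / <e_p>, as the quotient of the exterior algebra on the ground set of
   N by the ideal generated by the relations of OS(N) together with e_p. *)
Definition bias M CL : vectType K :=
  let N := extended_lift M CL in
  quot (ext_on K (ground N))
       (gen_ideal (ground N) (ext_e K [set new_point n] :: os_gens K N)).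

Definition bias_e M CL X : bias M CL := quot_class _ _ (ext_e K (emb X)).

Definition bias_degree M CL (h : nat) : {vspace bias M CL} :=
  <<[seq bias_e M CL X | X <- enum [set X in indep M | #|X| == h]]>>%VS.

(* The sign bringing x to the last place of the word of I:
   e_I = last_sign I x *: (e_(I \ x) /\ e_x). *)
Definition last_sign I (x : 'I_n) : K :=
  (-1) ^+ #|[set i in I | (x < i)%N]|.

(* The sign of the permutation sorting the word of I in which y is replaced
   by x. *)
Definition replace_sign I (x y : 'I_n) : K :=
  (-1) ^+ #|[set i in I | (minn x y < i < maxn x y)%N]|.

(* The value of p_x at e_I, where in the rule e_I |-> e_(I \ x) the word of I
   is taken with x in the last place: e_J /\ e_x |-> e_J.  Without that sign,
   which is 1 when x is the maximum of I, the values would not respect the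
   relations of the bias algebra, already for the uniform matroid U_(2,3). *)
Definition residue_e M CL (x : 'I_n) I :
    bias (contract M x) (contract_class M CL x) :=
  let e := bias_e (contract M x) (contract_class M CL x) in
  if x \in I then last_sign I x *: e (I :\ x)
  else if [pick y in I | [set x; y] \in CL] is Some y then
    replace_sign I x y *: (last_sign (x |: I :\ y) x *: e (I :\ y))
  else 0.

(* The linear map p_x with the prescribed values at the e_I, I independent;
   these span the bias algebra. *)
Definition residue M CL (x : 'I_n) :
    'Hom(bias M CL, bias (contract M x) (contract_class M CL x)) :=
  epsilon (inhabits 0)
    (fun f : 'Hom(bias M CL, bias (contract M x) (contract_class M CL x)) =>
       forall I, I \in indep M -> f (bias_e M CL I) = residue_e M CL x I).

(* The coefficient of e_set0; on the component of degree 0, the line spanned by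
   e_set0, it is the identification with K. *)
Definition degree0 M CL : 'Hom(bias M CL, K^o) :=
  linfun (fun z : bias M CL => (vsval z : exterior K n.+1) set0 : K^o).

Fixpoint residue_seq M CL (s : seq 'I_n) : 'Hom(bias M CL, K^o) :=
  if s is x :: s' then
    (residue_seq (contract M x) (contract_class M CL x) s' \o residue M CL x)%VF
  else degree0 M CL.

(* p_I for I = {i_1 < ... < i_h}: the map of i_h is applied first.  As p_x lowers
   degrees by one, this form on the whole algebra is the form p_I on the
   component of degree #|I| extended by 0 to the other components. *)
Definition residue_form M CL I : 'Hom(bias M CL, K^o) :=
  residue_seq M CL (rev (enum I)).

Definition residue_form_on M CL (h : nat) I :
    'Hom(subvs_of (bias_degree M CL h), K^o) :=
  (residue_form M CL I \o linfun vsval)%VF.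

End Bias.

Section NBC.
Variable n : nat.

Definition broken_circuits (CL : {set {set 'I_n}}) : {set {set 'I_n}} :=
  [set C :\ x | C in [set C in CL | (1 < #|C|)%N],
                x in [set x in C | [forall y in C, (x <= y)%N]]].

Definition NBC (M : matroid 'I_n) (CL : {set {set 'I_n}}) : {set {set 'I_n}} :=
  [set I in indep M | [forall B in broken_circuits CL, ~~ (B \subset I)]].

End NBC.

Definition dual_bases (K : fieldType) (V : vectType K) (T : finType) (A : {set T})
    (e : T -> V) (f : T -> 'Hom(V, K^o)) : Prop :=
  [/\ basis_of {:V} [seq e i | i <- enum A],
      basis_of {:'Hom(V, K^o)} [seq f i | i <- enum A] &
      {in A &, forall i j, f i (e j) = (i == j)%:R}].

(* Main.v *)
(* Contraction by the linear form with value 1 on e_x and on every e_y such that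
   {x, y} is in CL, and 0 on the other e_y, is an antiderivation of the exterior
   algebra.  It anticommutes with the boundary, hence carries the relations of
   Z(M, CL) into those of Z(M / x, CL / x); up to sign it is p_x, so p_x is well
   defined.  This uses the
   presentation of Z(M, CL) by e_C (C a circuit of M) and the boundaries of the
   members of CL: the further circuits of the lift avoiding p have nullity 2 in M
   and contribute nothing new.  The lift itself exists by Crapo's exchange argument
   on hyperplanes of the dual.
   For I and J without broken circuits, evaluate p_I at e_J one element at a time,
   from the largest element x of I.  If x is not in J, a nonzero value needs y in J
   and a circuit {x, y} of the current contracted class; lifted back to CL it is a
   circuit whose other elements lie in both I and J and exceed x, so removing its
   minimum leaves a broken circuit inside I or J.  Hence p_I(e_J) is 0 unless
   I = J.  Straightening by boundaries of circuits shows that the e_J span, and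
   spanning together with the pairing gives both bases. *)
From HB Require Import structures.
Require Import Defs.
From mathcomp Require Import all_boot all_order all_algebra all_field.
From mathcomp Require Import zify.
From Stdlib Require Import ClassicalEpsilon.
Import Defs.

Set Implicit Arguments.
Unset Strict Implicit.
Unset Printing Implicit Defensive.

(** * Rank, circuits and hyperplanes *)

Import GRing.Theory.

(* lia is very slow when membership hypotheses are left in the context, and it
   does not identify terms that differ by a reverse coercion. *)
Ltac rklia :=
  repeat match goal with
  | H : is_true (in_mem _ _) |- _ => clear H
  | H : is_true (~~ _) |- _ => clear H
  | H : is_true (subset _ _) |- _ => clear H
  | H : forall _, _ |- _ => clear H
  end; unfold reverse_coercion in *; lia.

(** The forms are composed along successive contractions, but [extended_lift] chooses a lift for
    each pair separately, so the lifts of [M] and of [M / x] have no direct relation to each other.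
    The presentation bridges them: its relations mention only the matroid and its class, and both
    ideals live in one exterior algebra, where inclusions are checked on generators. The pairing is
    not symmetric in [I] and [J]. After contracting the largest element x of [I], the set [J \ x]
    may contain a broken circuit of the contracted class whose minimum exceeds x: the minimum of the
    original circuit was x itself. For [I] this cannot happen, since all of [I \ x] lies below x.
    The induction therefore keeps for [J] only the broken circuits whose minimum is at most some
    remaining element of [I]. It compares sets of any two sizes, so the same computation serves each
    degree and the whole algebra. Matroid arguments are phrased as rank equations: closure,
    circuits, hyperplanes, duality and contraction each get a rank formula, and what remains is
    arithmetic. *)

Section Rank.
Variable T : finType.
Implicit Types (M : matroid T) (A B C I J X : {set T}) (x y : T).

Lemma indep_ground M I : I \in indep M -> I \subset ground M.
Proof. by have [h _ _ _] := matroidP M; apply: h. Qed.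

Lemma indep0 M : set0 \in indep M.
Proof. by have [] := matroidP M. Qed.

Lemma indepS M I J : J \subset I -> I \in indep M -> J \in indep M.
Proof. by have [_ _ h _] := matroidP M => sJ iI; apply: h sJ. Qed.

Lemma indep_aug M I J : I \in indep M -> J \in indep M -> #|I| < #|J| ->
  exists2 x, x \in J :\: I & x |: I \in indep M.
Proof. by have [_ _ _ h] := matroidP M; apply: h. Qed.

Lemma indep_le_rk M I A : I \in indep M -> I \subset A -> #|I| <= rk M A.
Proof.
by move=> iI sI; apply: (bigmax_sup I) => //; apply/andP.
Qed.

Lemma rk_witness M A :
  exists I, [/\ I \in indep M, I \subset A & #|I| = rk M A].
Proof.
have P0 : (set0 \in indep M) && (set0 \subset A) by rewrite indep0 sub0set.
have [I /andP[iI sI] max] := @arg_maxnP _ set0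
  (fun I => (I \in indep M) && (I \subset A)) (fun I => #|I|) P0.
exists I; split => //; apply/eqP; rewrite eqn_leq; apply/andP; split.
  by apply: (bigmax_sup I) => //; apply/andP.
by apply/bigmax_leqP => J; apply: max.
Qed.

Lemma rk_le_card M A : rk M A <= #|A|.
Proof. by have [I [_ sI <-]] := rk_witness M A; apply: subset_leq_card. Qed.

Lemma rkS M A B : A \subset B -> rk M A <= rk M B.
Proof.
have [I [iI sI <-]] := rk_witness M A => sAB.
by apply: indep_le_rk => //; apply: subset_trans sAB.
Qed.

Lemma rk0 M : rk M set0 = 0.
Proof. by have := rk_le_card M set0; rewrite cards0; case: rk. Qed.

Lemma indep_rk M A : (A \in indep M) = (rk M A == #|A|).
Proof.
apply/idP/eqP => [iA|].
  by apply/eqP; rewrite eqn_leq rk_le_card indep_le_rk.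
have [I [iI sI <-] e] := rk_witness M A.
by have /eqP <- : I == A by rewrite eqEcard sI e leqnn.
Qed.

Lemma dep_rk M A : (A \notin indep M) = (rk M A < #|A|).
Proof. by rewrite indep_rk ltn_neqAle rk_le_card andbT. Qed.

Lemma extend_to_rk M I A : I \in indep M -> I \subset A ->
  exists J, [/\ J \in indep M, I \subset J, J \subset A & #|J| = rk M A].
Proof.
have [K [iK sK eK]] := rk_witness M A.
have [k] := ubnP (#|K| - #|I|); elim: k I => // k IHk I ltk iI sI.
case: (ltnP #|I| #|K|) => [lt|le]; last first.
  by exists I; split => //; apply/eqP; rewrite eqn_leq indep_le_rk // -eK.
have [x /setDP[xK xI] ixI] := indep_aug iI iK lt.
have [||J [iJ sJ sJA eJ]] := IHk (x |: I) _ ixI.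
- by rewrite cardsU1 xI /=; rklia.
- by rewrite subUset sub1set sI (subsetP sK).
by exists J; split=> //; apply: subset_trans sJ; apply: subsetUr.
Qed.

(** A basis of [A :&: B] is extended to one of [A :|: B]; its traces on [A] and [B] are independent
    and both contain the basis started from. *)
Lemma rk_submod M A B : rk M (A :|: B) + rk M (A :&: B) <= rk M A + rk M B.
Proof.
have [I [iI sI eI]] := rk_witness M (A :&: B).
have sIU : I \subset A :|: B.
  by apply: subset_trans sI _; apply: subset_trans (subsetIl _ _) (subsetUl _ _).
have [J [iJ sIJ sJ <-]] := extend_to_rk iI sIU.
have a : #|J :&: A| <= rk M A.
  by apply: indep_le_rk; rewrite ?subsetIr //; apply: indepS iJ; apply: subsetIl.
have b : #|J :&: B| <= rk M B.
  by apply: indep_le_rk; rewrite ?subsetIr //; apply: indepS iJ; apply: subsetIl.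
have e : J = (J :&: A) :|: (J :&: B) by rewrite -setIUr; apply/esym/setIidPl.
have := cardsUI (J :&: A) (J :&: B); rewrite -e.
have : #|I| <= #|(J :&: A) :&: (J :&: B)|.
  by rewrite subset_leq_card // -setIIr subsetI sIJ.
rklia.
Qed.

Lemma rkU1_le M A x : rk M (x |: A) <= (rk M A).+1.
Proof.
have := rk_submod M [set x] A; have := rk_le_card M [set x]; rewrite cards1; rklia.
Qed.

(** The equation [rk M (x |: A) = rk M A] is the working form of membership of [x] in the closure of
    [A]; by submodularity it passes to larger sets. *)
Lemma rkU1_mono M A B x : A \subset B -> rk M (x |: A) = rk M A ->
  rk M (x |: B) = rk M B.
Proof.
move=> sAB e; have := rk_submod M (x |: A) B.
have -> : x |: A :|: B = x |: B by rewrite -setUA (setUidPr sAB).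
have : rk M A <= rk M ((x |: A) :&: B) by apply: rkS; rewrite subsetI subsetUr.
have : rk M B <= rk M (x |: B) by apply/rkS/subsetUr.
rklia.
Qed.

Lemma rkU_mono M A B : (forall y, y \in B -> rk M (y |: A) = rk M A) ->
  rk M (A :|: B) = rk M A.
Proof.
move=> h; have [k] := ubnP #|B|; elim: k B h => // k IHk B h.
have [->|/set0Pn[y yB]] := eqVneq B set0; first by rewrite setU0.
rewrite (cardsD1 y) yB ltnS => lt.
have e := IHk (B :\ y) _ lt; rewrite -[in RHS]e; last by move=> z /setD1P[_ /h].
have {1}-> : A :|: B = y |: (A :|: B :\ y) by rewrite setUCA setD1K.
by apply: rkU1_mono (h y yB); apply: subsetUl.
Qed.

Lemma circuitP M C : reflect
  [/\ C \subset ground M, (rk M C).+1 = #|C| & forall x, x \in C -> rk M (C :\ x) = rk M C]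
  (C \in circuits M).
Proof.
rewrite inE; apply: (iffP and3P) => [[sC dC /forall_inP h]|[sC e h]]; split=> //.
- move: dC; rewrite dep_rk => lt.
  have [x xC] : exists x, x \in C by apply/set0Pn; apply: contraTneq lt => ->; rewrite cards0.
  move: (h x xC); rewrite indep_rk => /eqP e; have := rkS M (subsetDl C [set x]).
  have := cardsD1 x C; rewrite xC; rklia.
- move=> x xC; move: (h x xC); rewrite indep_rk => /eqP e; move: dC; rewrite dep_rk.
  have := rkS M (subsetDl C [set x]); have := cardsD1 x C; rewrite xC; rklia.
- by rewrite dep_rk -e.
- apply/forall_inP => x xC; rewrite indep_rk h //; have := cardsD1 x C; rewrite xC; rklia.
Qed.

Lemma circuit_dep M C : C \in circuits M -> C \notin indep M.
Proof. by rewrite inE => /and3P[]. Qed.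

Lemma circuit_ground M C : C \in circuits M -> C \subset ground M.
Proof. by rewrite inE => /and3P[]. Qed.

Lemma circuit_indepD1 M C x : C \in circuits M -> x \in C -> C :\ x \in indep M.
Proof. by rewrite inE => /and3P[_ _ /forall_inP h]; apply: h. Qed.

Lemma circuit_proper M C X : C \in circuits M -> X \proper C -> X \in indep M.
Proof.
move=> cC /properP[sX [x xC xX]]; apply: indepS (circuit_indepD1 cC xC).
by rewrite subsetD1 sX.
Qed.

Lemma circuit_neq0 M C : C \in circuits M -> C != set0.
Proof. by move=> cC; apply: contraTneq (circuit_dep cC) => ->; rewrite negbK indep0. Qed.

Lemma dep_circuit M A : A \subset ground M -> A \notin indep M ->
  exists2 C, C \in circuits M & C \subset A.
Proof.
move=> sA dA; have [C /minsetP[dC min] sC] := @minset_exists _ (fun B : {set T} => B \notin indep M) A dA.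
  exists C => //; rewrite inE (subset_trans sC sA) dC; apply/forall_inP => x xC.
  apply/negPn/negP => d; have := min _ d (subsetDl _ _) => /setP/(_ x).
  by rewrite !inE eqxx xC.
Qed.

Lemma closureS M A x : x \in ground M -> A \subset ground M ->
  (x \notin closure M A) = (rk M (x |: A) == (rk M A).+1).
Proof.
move=> xG _; rewrite inE xG /=; have := rkU1_le M A x.
have : rk M A <= rk M (x |: A) by apply/rkS/subsetUr.
rklia.
Qed.

Lemma hyperplaneP M (H : {set T}) : reflect
  [/\ H \subset ground M, (rk M H).+1 = rk M (ground M) &
      forall x, x \in ground M -> x \notin H -> rk M (x |: H) = rk M (ground M)]
  (H \in hyperplanes M).
Proof.
rewrite inE; apply: (iffP and3P) => [[sH /eqP cH /eqP e]|[sH e h]].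
  split=> // x xG; rewrite -{1}cH closureS // => /eqP ->; exact: e.
split=> //; last by apply/eqP.
apply/eqP/setP => x; rewrite inE; apply/idP/idP => [/andP[xG /eqP ex]|xH].
  by apply/negPn/negP => /(h x xG); rklia.
by rewrite (subsetP sH) //= (setUidPr _) // sub1set.
Qed.

Lemma flat_span M (H : {set T}) A x : H \in hyperplanes M -> x \in ground M -> A \subset H ->
  rk M (x |: A) = rk M A -> x \in H.
Proof.
move=> /hyperplaneP[sH e h] xG sA ex; apply/negPn/negP => xH.
by have := rkU1_mono sA ex; rewrite h //; rklia.
Qed.

Lemma hyperplane_eq M (H H' : {set T}) A : H \in hyperplanes M -> H' \in hyperplanes M ->
  A \subset H -> A \subset H' -> (rk M A).+1 = rk M (ground M) -> H = H'.
Proof.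
have aux (H1 H2 : {set T}) : H1 \in hyperplanes M -> H2 \in hyperplanes M ->
  A \subset H1 -> A \subset H2 -> (rk M A).+1 = rk M (ground M) -> H1 \subset H2.
  move=> h1 h2 s1 s2 e; have /hyperplaneP[sH1 e1 _] := h1.
  apply/subsetP => x xH; apply: (flat_span h2 _ s2); first exact: (subsetP sH1).
  have : rk M (x |: A) <= rk M H1 by apply: rkS; rewrite subUset sub1set xH.
  have : rk M A <= rk M (x |: A) by apply/rkS/subsetUr.
  rklia.
by move=> h1 h2 s1 s2 e; apply/eqP; rewrite eqEsubset; apply/andP; split; apply: aux.
Qed.

Lemma hyperplane_exists M A : A \subset ground M -> (rk M A).+1 = rk M (ground M) ->
  exists2 H, H \in hyperplanes M & A \subset H.
Proof.
move=> sA e; exists (closure M A); last first.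
  apply/subsetP => x xA; rewrite inE (subsetP sA) //= (setUidPr _) //.
  by rewrite sub1set.
have sAc : A \subset closure M A.
  apply/subsetP => x xA; rewrite inE (subsetP sA) //= (setUidPr _) //.
  by rewrite sub1set.
have ec : rk M (closure M A) = rk M A.
  by rewrite -(setUidPr sAc); apply: rkU_mono => y; rewrite inE => /andP[_ /eqP].
apply/hyperplaneP; split; rewrite ?ec //.
  by apply/subsetP => x; rewrite inE => /andP[].
move=> x xG; rewrite closureS // => /eqP ex.
have : rk M (x |: A) <= rk M (x |: closure M A) by apply/rkS/setUS.
have : rk M (x |: closure M A) <= rk M (ground M).
  apply: rkS; rewrite subUset sub1set xG /=.
  by apply/subsetP => z; rewrite inE => /andP[].
rklia.
Qed.

Lemma basesE M B : (B \in bases M) = (B \in indep M) && (#|B| == rk M (ground M)).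
Proof.
rewrite inE; apply: andb_id2l => iB; apply/forall_inP/eqP => [h|-> I iI].
  apply/eqP; rewrite eqn_leq indep_le_rk ?indep_ground //.
  by have [I [iI _ <-]] := rk_witness M (ground M); apply: h.
exact: indep_le_rk (indep_ground iI).
Qed.

(** The corank formula, written additively to avoid truncated subtraction. *)
Lemma rk_dual M A : A \subset ground M ->
  rk (dual M) A + rk M (ground M) = #|A| + rk M (ground M :\: A).
Proof.
move=> sA; set G := ground M.
have dualE X : (X \in indep (dual M)) =
    (X \subset G) && [exists B in bases M, [disjoint X & B]] by rewrite /= inE.
apply/eqP; rewrite eqn_leq; apply/andP; split.
  have [X [+ sX <-]] := rk_witness (dual M) A.
  rewrite dualE => /andP[_ /exists_inP[B]]; rewrite basesE => /andP[iB /eqP <-] dX.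
  have h1 : #|B :\: A| <= rk M (G :\: A).
    by apply: indep_le_rk; [apply: indepS iB; apply: subsetDl|apply/setSD/indep_ground].
  have h2 : #|X :|: (B :&: A)| <= #|A| by rewrite subset_leq_card // subUset sX subsetIr.
  have := cardsUI X (B :&: A); have -> : X :&: (B :&: A) = set0.
    by apply/eqP; rewrite setIA (eqP (_ : X :&: B == set0)) ?set0I // setI_eq0.
  by rewrite cards0; have := cardsID A B; rklia.
(* A base [B] grown from a basis of [G :\: A] meets [A] in as few elements as possible, so [A :\: B]
   is a coindependent set of the required size. *)
have [I [iI sI <-]] := rk_witness M (G :\: A).
have [B [iB sIB sB eB]] := extend_to_rk iI (subset_trans sI (subsetDl _ _)).
have iX : A :\: B \in indep (dual M).
  rewrite dualE (subset_trans (subsetDl _ _) sA); apply/exists_inP; exists B.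
    by rewrite basesE iB eB eqxx.
  by rewrite disjoint_sym disjoints_subset; apply/subsetP => z zB; rewrite !inE zB.
have := indep_le_rk iX (subsetDl _ _); rewrite -/G -eB.
have : #|I| <= #|B :\: A|.
  rewrite subset_leq_card //; apply/subsetP => z zI; rewrite inE (subsetP sIB) // andbT.
  by have /setDP[] := subsetP sI z zI.
have := cardsID A B; have := cardsID B A; rewrite (setIC A B); rklia.
Qed.

Lemma ground_dual M : ground (dual M) = ground M.
Proof. by []. Qed.

(** Complementation turns a class of circuits into a class of hyperplanes of the dual, the form in
    which Crapo's construction takes its data. Both directions are read off the corank formula. *)
Lemma dual_hyperplane M C : C \subset ground M ->
  (ground M :\: C \in hyperplanes (dual M)) = (C \in circuits M).
Proof.
move=> sC; have sD A : ground M :\: A \subset ground M by apply: subsetDl.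
have DD A : A \subset ground M -> ground M :\: (ground M :\: A) = A.
  by move=> sA; rewrite setDDr setDv set0U; apply/setIidPr.
have cD A : A \subset ground M -> #|ground M :\: A| + #|A| = #|ground M|.
  by move=> sA; have := cardsID A (ground M); rewrite (setIidPr sA); rklia.
have eG := rk_dual (subxx (ground M)); rewrite setDv rk0 in eG.
have eH := rk_dual (sD C); rewrite DD // in eH; have cC := cD _ sC.
have hx x : x \in C -> [/\ x |: (ground M :\: C) = ground M :\: (C :\ x) &
   rk (dual M) (x |: (ground M :\: C)) + rk M (ground M) =
   (#|ground M :\: C|).+1 + rk M (C :\ x)].
  move=> xC; have xG := subsetP sC x xC.
  have e : x |: (ground M :\: C) = ground M :\: (C :\ x).
    by apply/setP => z; rewrite !inE negb_and negbK; case: eqP => // ->; rewrite xG.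
  split => //; have sCx := subset_trans (subsetDl C [set x]) sC.
  by rewrite e (rk_dual (sD _)) DD //; have := cD _ sCx; have := cardsD1 x C; rewrite xC; rklia.
apply/hyperplaneP/circuitP => -[_ e h]; split => //; rewrite ?ground_dual in e h *; try rklia.
  move=> x xC; have [_ ex] := hx x xC; have := h x (subsetP sC x xC).
  by rewrite inE xC /= => /(_ isT); rklia.
move=> x xG; rewrite inE xG andbT negbK => xC; have [_ ex] := hx x xC; have := h x xC; rklia.
Qed.

Lemma contract_indepE M x I : [set x] \in indep M ->
  (I \in indep (contract M x)) = (x \notin I) && (x |: I \in indep M).
Proof. by move=> ix; rewrite /indep /= /contract_indep ix inE. Qed.

Lemma ground_contract M x : ground (contract M x) = ground M :\ x.
Proof. by []. Qed.

Lemma rk_contract M x A : [set x] \in indep M ->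
  (rk (contract M x) A).+1 = rk M (x |: A).
Proof.
move=> ix; apply/eqP; rewrite eqn_leq; apply/andP; split.
  have [I [+ sI <-]] := rk_witness (contract M x) A; rewrite contract_indepE // => /andP[xI iI].
  have := indep_le_rk iI (setUS [set x] sI); by rewrite cardsU1 xI.
have [J [iJ sJ sJA <-]] := extend_to_rk ix (subsetUl [set x] A).
have xJ : x \in J by rewrite -sub1set.
rewrite (cardsD1 x) xJ ltnS; apply: indep_le_rk.
  by rewrite contract_indepE // setD1K // !inE eqxx.
by rewrite subDset.
Qed.

Lemma singleton_rk M x : ([set x] \in indep M) = (rk M [set x] == 1).
Proof. by rewrite indep_rk cards1. Qed.

End Rank.

(** * Single-element extensions *)

Section Emb.
Variable n : nat.
Implicit Types (X : {set 'I_n}) (Y : {set 'I_n.+1}) (i : 'I_n).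

Definition unemb Y : {set 'I_n} := [set i | lift ord_max i \in Y].

Lemma lift_inj_max : injective (lift (@ord_max n)).
Proof. exact: lift_inj. Qed.

Lemma mem_emb X i : (lift ord_max i \in emb X) = (i \in X).
Proof. by rewrite mem_imset //; apply: lift_inj. Qed.

Lemma embP (z : 'I_n.+1) X :
  reflect (exists2 i : 'I_n, i \in X & z = lift ord_max i) (z \in emb X).
Proof. exact: imsetP. Qed.

Lemma new_point_emb X : new_point n \in emb X = false.
Proof.
apply/imsetP => -[i _ e]; have := neq_lift (@ord_max n) i.
by rewrite -e /new_point eqxx.
Qed.

Lemma lift_neq_new i : (lift ord_max i == new_point n) = false.
Proof. by rewrite eq_sym; apply/negbTE/neq_lift. Qed.

Lemma new_or_lift (z : 'I_n.+1) : z = new_point n \/ exists i, z = lift ord_max i.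
Proof.
by case: (unliftP (@ord_max n) z) => [j ->|->]; [right; exists j|left].
Qed.

Lemma setP_new Y Y' : (new_point n \in Y) = (new_point n \in Y') ->
  unemb Y = unemb Y' -> Y = Y'.
Proof.
move=> ep /setP eu; apply/setP => z.
by case: (new_or_lift z) => [-> //|[i ->]]; have := eu i; rewrite !inE.
Qed.

Lemma unembK X : unemb (emb X) = X.
Proof. by apply/setP => i; rewrite inE mem_emb. Qed.

Lemma emb_inj : injective (@emb n).
Proof. exact: can_inj unembK. Qed.

Lemma card_emb X : #|emb X| = #|X|.
Proof. by rewrite card_imset //; apply: lift_inj. Qed.

Lemma embS X X' : (emb X \subset emb X') = (X \subset X').
Proof.
apply/idP/idP => [/subsetP h|]; last exact: imsetS.
by apply/subsetP => i iX; rewrite -mem_emb h // mem_emb.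
Qed.

Lemma emb0 : emb set0 = set0 :> {set 'I_n.+1}.
Proof. exact: imset0. Qed.

Lemma embD X X' : emb (X :\: X') = emb X :\: emb X'.
Proof.
apply: setP_new; first by rewrite !inE !new_point_emb andbF.
by apply/setP => i; rewrite !inE !mem_emb inE.
Qed.

Lemma embU X X' : emb (X :|: X') = emb X :|: emb X'.
Proof. exact: imsetU. Qed.

Lemma emb1 i : emb [set i] = [set lift ord_max i].
Proof. exact: imset_set1. Qed.

Lemma emb_unemb Y : new_point n \notin Y -> emb (unemb Y) = Y.
Proof.
by move=> pY; apply: setP_new; rewrite ?unembK // new_point_emb (negPf pY).
Qed.

Lemma emb_unembU Y : new_point n \in Y -> new_point n |: emb (unemb Y) = Y.
Proof.
move=> pY; apply: setP_new; first by rewrite !inE eqxx pY.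
by apply/setP => i; rewrite !inE mem_emb lift_neq_new inE.
Qed.

Lemma unembU1 Y : unemb (new_point n |: Y) = unemb Y.
Proof. by apply/setP => i; rewrite !inE lift_neq_new. Qed.

Lemma unembUlift Y i : unemb (lift ord_max i |: Y) = i |: unemb Y.
Proof. by apply/setP => j; rewrite !inE (inj_eq lift_inj_max). Qed.

Lemma unembS Y Y' : Y \subset Y' -> unemb Y \subset unemb Y'.
Proof. by move=> /subsetP h; apply/subsetP => i; rewrite !inE => /h. Qed.

Lemma card_unemb Y : #|Y| = #|unemb Y| + (new_point n \in Y).
Proof.
have [pY|pY] := boolP (new_point n \in Y).
  by rewrite -{1}(emb_unembU pY) cardsU1 new_point_emb card_emb addnC.
by rewrite -{1}(emb_unemb pY) card_emb addn0.
Qed.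

Lemma rk_emb (P : matroid 'I_n) (D : matroid 'I_n.+1) X :
  (forall Z : {set 'I_n}, (emb Z \in indep D) = (Z \in indep P)) -> rk D (emb X) = rk P X.
Proof.
move=> eD; apply/eqP; rewrite eqn_leq; apply/andP; split.
  have [I [iI sI <-]] := rk_witness D (emb X).
  have pI : new_point n \notin I by apply: contraFN (new_point_emb X) => /(subsetP sI).
  rewrite -(emb_unemb pI) card_emb; apply: indep_le_rk; first by rewrite -eD emb_unemb.
  by have := unembS sI; rewrite unembK.
have [I [iI sI <-]] := rk_witness P X; rewrite -card_emb.
by apply: indep_le_rk; rewrite ?embS // eD.
Qed.

End Emb.

(** * Crapo's extension attached to a linear subclass of hyperplanes *)

Section Crapo.
Variables (n : nat) (P : matroid 'I_n) (sel : pred {set 'I_n}).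
Implicit Types (X Y W H : {set 'I_n}) (x y : 'I_n).

Hypothesis sel_linear : forall H1 H2 H : {set 'I_n}, H1 \in hyperplanes P -> H2 \in hyperplanes P ->
  H \in hyperplanes P -> sel H1 -> sel H2 ->
  rk P H1 + rk P H2 = rk P (H1 :|: H2) + rk P (H1 :&: H2) ->
  H1 :&: H2 \subset H -> sel H.

(* The sets that stay independent when the new point is added to them. *)
Let new_free X := [exists H in hyperplanes P, ~~ sel H && (X \subset H)].

Lemma new_freeP X : reflect (exists H, [/\ H \in hyperplanes P, ~~ sel H & X \subset H]) (new_free X).
Proof.
by apply: (iffP exists_inP) => [[H hH /andP[]]|[H [hH sH sX]]]; exists H; rewrite // sH.
Qed.

(** The only use of linearity. If both conclusions fail, the hyperplanes through [y1 |: W] and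
    [y2 |: W] are selected for a suitable [W] of corank 2 inside [H]. They form a modular pair whose
    intersection is spanned by [W], hence lies in [H], and linearity would select [H]. *)
Lemma new_free_exchange X y1 y2 : new_free X -> y1 != y2 ->
  y1 \notin X -> y2 \notin X -> y1 |: (y2 |: X) \in indep P ->
  new_free (y1 |: X) || new_free (y2 |: X).
Proof.
move=> /new_freeP[H [hH sH sX]] ne n1 n2 iX2.
have okU y H' : H' \in hyperplanes P -> ~~ sel H' -> y |: X \subset H' -> new_free (y |: X).
  by move=> *; apply/new_freeP; exists H'.
have [y1H|y1H] := boolP (y1 \in H); first by rewrite (okU _ H) ?subUset ?sub1set ?y1H.
have [y2H|y2H] := boolP (y2 \in H); first by rewrite orbC (okU _ H) ?subUset ?sub1set ?y2H.
have /hyperplaneP[sHG eH maxH] := hH.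
have iX : X \in indep P by apply: indepS iX2; rewrite setUA subsetUr.
have [B [iB sXB sBH eB]] := extend_to_rk iX sX.
have /subsetP gX2 := indep_ground iX2.
have g1 : y1 \in ground P by apply: gX2; rewrite !inE eqxx.
have g2 : y2 \in ground P by apply: gX2; rewrite !inE eqxx orbT.
have rkB : rk P B = rk P H by rewrite -eB; apply/eqP; rewrite -indep_rk.
have rB1 : rk P (y1 |: B) = rk P (ground P).
  have : rk P (y1 |: B) <= rk P (ground P).
    by apply: rkS; rewrite subUset sub1set g1 indep_ground.
  have : rk P (y1 |: B) <> rk P B.
    by move=> /(rkU1_mono sBH); rewrite maxH //; rklia.
  have : rk P B <= rk P (y1 |: B) by apply/rkS/subsetUr.
  rklia.
(* Completing [y1 |: (y2 |: X)] to a base inside [y1 |: (y2 |: B)] and removing [y1] and [y2] gives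
   [W] with [X \subset W], [W \subset B] and corank 2. *)
have sXB2 : y1 |: (y2 |: X) \subset y1 |: (y2 |: B) by rewrite !setUS.
have [B' [iB' sXB' sB'B eB']] := extend_to_rk iX2 sXB2.
have gB' := indep_ground iB'.
have cB' : #|B'| = rk P (ground P).
  have : rk P (y1 |: B) <= rk P (y1 |: (y2 |: B)) by apply/rkS/setUS/subsetUr.
  have := indep_le_rk iB' gB'; rklia.
pose W := B' :\ y1 :\ y2.
have y1B' : y1 \in B' by apply: (subsetP sXB'); rewrite !inE eqxx.
have y2B' : y2 \in B' by apply: (subsetP sXB'); rewrite !inE eqxx orbT.
have iW : W \in indep P.
  by apply: indepS iB'; apply: subset_trans (subsetDl _ _) (subsetDl _ _).
have cW : #|W|.+2 = rk P (ground P).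
  by rewrite -cB' (cardsD1 y1 B') y1B' (cardsD1 y2 (B' :\ y1)) !inE eq_sym ne y2B'.
have sXW : X \subset W.
  rewrite !subsetD1 n1 n2 !andbT; apply: subset_trans sXB'.
  by rewrite setUA subsetUr.
have sWH : W \subset H.
  apply: subset_trans sBH; apply/subsetP => z; rewrite !inE => /and3P[z2 z1 /(subsetP sB'B)].
  by rewrite !inE (negPf z1) (negPf z2).
have hy y : y \in B' -> y \notin W ->
    (exists H', [/\ H' \in hyperplanes P, y |: W \subset H' & sel H']) \/
    new_free (y |: X).
  move=> yB' yW; have iyW : y |: W \in indep P.
    apply: indepS iB'; rewrite subUset sub1set yB' /W.
    exact: subset_trans (subsetDl _ _) (subsetDl _ _).
  have [||H' hH' sH'] := hyperplane_exists (M := P) (A := y |: W).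
  - exact: indep_ground.
  - by move: iyW; rewrite indep_rk => /eqP ->; rewrite cardsU1 yW.
  have [s|s] := boolP (sel H'); first by left; exists H'.
  by right; apply: (okU _ H') => //; apply: subset_trans sH'; apply: setUS.
have y1W : y1 \notin W by rewrite !inE eqxx andbF.
have y2W : y2 \notin W by rewrite !inE eqxx.
have [[H1 [hH1 sH1 s1]]|->//] := hy y1 y1B' y1W.
have [[H2 [hH2 sH2 s2]]|->] := hy y2 y2B' y2W; last by rewrite orbT.
case/negP: sH.
have /hyperplaneP[sG1 e1 _] := hH1; have /hyperplaneP[sG2 e2 _] := hH2.
have rU : rk P (H1 :|: H2) = rk P (ground P).
  apply/eqP; rewrite eqn_leq rkS ?subUset ?sG1 //= -cB'; apply: indep_le_rk => //.
  apply/subsetP => z zB'; rewrite inE.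
  have [->|z1] := eqVneq z y1; first by rewrite (subsetP sH1) // !inE eqxx.
  have [->|z2] := eqVneq z y2; first by rewrite (subsetP sH2) ?orbT // !inE eqxx.
  by rewrite (subsetP sH1) // !inE z1 z2 zB' orbT.
have sWI : W \subset H1 :&: H2.
  by rewrite subsetI (subset_trans (subsetUr _ _) sH1) (subset_trans (subsetUr _ _) sH2).
have rW := indep_le_rk iW sWI.
have sm := rk_submod P H1 H2.
apply: (sel_linear hH1 hH2 hH s1 s2); first rklia.
apply/subsetP => z zH; have zG : z \in ground P by case/setIP: zH => /(subsetP sG1).
apply: (flat_span hH zG sWH); have : rk P (z |: W) <= rk P (H1 :&: H2).
  by apply: rkS; rewrite subUset sub1set zH.
have : rk P W <= rk P (z |: W) by apply/rkS/subsetUr.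
by move: iW; rewrite indep_rk => /eqP; rklia.
Qed.

(** A hyperplane containing [Y] contains everything that [Y] spans, so the same unselected
    hyperplane is a witness. *)
Lemma new_free_span X Y : new_free Y -> X \subset ground P -> Y \in indep P ->
  rk P (X :|: Y) = #|Y| -> new_free (X :|: Y).
Proof.
move=> /new_freeP[H [hH sH sY]] gX iY e; apply/new_freeP; exists H; split=> //.
rewrite subUset sY andbT; apply/subsetP => x xX.
apply: (flat_span hH (subsetP gX x xX) sY).
have : rk P (x |: Y) <= rk P (X :|: Y) by apply/rkS/setSU; rewrite sub1set.
have : rk P Y <= rk P (x |: Y) by apply/rkS/subsetUr.
by move: iY; rewrite indep_rk => /eqP; rklia.
Qed.

Lemma new_freeS X Y : X \subset Y -> new_free Y -> new_free X.
Proof.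
by move=> s /new_freeP[H [hH sH sY]]; apply/new_freeP; exists H; split => //; apply: subset_trans sY.
Qed.

Lemma indep_grow X Y : X \in indep P ->
  (exists y, [/\ y \in Y, y \notin X & y |: X \in indep P]) \/ rk P (X :|: Y) = #|X|.
Proof.
move=> iX; have rX : rk P X = #|X| by apply/eqP; rewrite -indep_rk.
have [/exists_inP[y yY /andP[yX iy]]|/exists_inPn h] :=
  boolP [exists y in Y, (y \notin X) && (y |: X \in indep P)].
  by left; exists y.
right; rewrite -rX; apply: rkU_mono => y yY.
have [yX|yX] := boolP (y \in X); first by rewrite (setUidPr _) // sub1set.
have := h y yY; rewrite yX /= dep_rk cardsU1 yX.
have : rk P X <= rk P (y |: X) by apply/rkS/subsetUr.
rklia.
Qed.

Definition extension_indep : {set {set 'I_n.+1}} :=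
  [set Y | (unemb Y \in indep P) && ((new_point n \in Y) ==> new_free (unemb Y))].

(** The delicate case of augmentation has the new point in [I]: adding an element [y1] to the trace
    of [I] may destroy freeness. If a second element [y2] can still be added, the exchange lemma
    allows [y1] or [y2]. Otherwise [y1 |: X] spans [Y]; the sizes then force the new point into [J],
    and the freeness of [Y] passes to [y1 |: X]. *)
Lemma extension_axioms :
  matroid_axioms (new_point n |: emb (ground P), extension_indep).
Proof.
apply/matroid_axiomsP; split.
- move=> I /[!inE]/andP[iI _]; apply/subsetP => z zI; rewrite !inE.
  case: (new_or_lift z) zI => [->|[i ->] zI]; first by rewrite eqxx.
  by rewrite mem_emb (subsetP (indep_ground iI)) ?orbT // inE.
- have -> : set0 = emb set0 :> {set 'I_n.+1} by rewrite emb0.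
  by rewrite inE unembK new_point_emb indep0.
- move=> I J /[!inE]/andP[iI /implyP oI] sJI; rewrite (indepS (unembS sJI)) //=.
  by apply/implyP => /(subsetP sJI)/oI; apply/new_freeS/unembS.
move=> I J /[!inE]/andP[iI /implyP oI]/andP[iJ /implyP oJ]; rewrite !card_unemb.
set X := unemb I in iI oI *; set Y := unemb J in iJ oJ *.
have rX : rk P X = #|X| by apply/eqP; rewrite -indep_rk.
have rY : rk P Y = #|Y| by apply/eqP; rewrite -indep_rk.
have addl y : y \in Y -> y \notin X -> y |: X \in indep P ->
    (new_point n \in I -> new_free (y |: X)) ->
    exists2 x, x \in J :\: I & x |: I \in extension_indep.
  rewrite !inE => yY yX iy oky; exists (lift ord_max y); first by rewrite inE yX.
  rewrite inE unembUlift iy !inE eq_sym lift_neq_new /=; exact/implyP.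
case: (boolP (new_point n \in I)) => pI lt; last first.
  case: (indep_grow Y iI) => [[y [yY yX iy]]|e].
    by apply: (addl y) => //; rewrite (negPf pI).
  have le : #|Y| <= #|X| by rewrite -e -rY; apply/rkS/subsetUr.
  have [pJ eXY] : new_point n \in J /\ #|X| = #|Y| by rklia.
  exists (new_point n); first by rewrite inE pI.
  rewrite inE unembU1 iI /=; apply/implyP => _.
  apply: new_freeS (subsetUl X Y) _; apply: new_free_span; rewrite ?indep_ground ?e //; exact: oJ.
have okX := oI pI.
have ltXY : #|X| < #|Y| by rklia.
have [y1 /setDP[y1Y y1X] iy1] := indep_aug iI iJ ltXY.
have ry1 : rk P (y1 |: X) = #|X|.+1.
  by move: iy1; rewrite indep_rk => /eqP ->; rewrite cardsU1 y1X.
case: (indep_grow Y iy1) => [[y2 [y2Y]]|e].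
  rewrite in_setU1 negb_or => /andP[ne y2X] iy2.
  have iy2' : y2 |: X \in indep P by apply: indepS iy2; rewrite setUS // subsetUr.
  have := new_free_exchange okX ne y2X y1X iy2; case/orP => o.
    by apply: (addl y2).
  by apply: (addl y1).
rewrite cardsU1 y1X in e.
have le : #|Y| <= #|X|.+1 by rewrite -[X in _ <= X]e -rY; apply/rkS/subsetUr.
have [pJ eXY] : new_point n \in J /\ #|X|.+1 = #|Y| by rklia.
apply: (addl y1) => // _; apply: new_freeS (subsetUl _ Y) _.
by apply: new_free_span; rewrite ?indep_ground ?e //; apply: oJ.
Qed.

Definition one_extension : matroid 'I_n.+1 := Matroid extension_axioms.

Lemma one_extension_indep (Y : {set 'I_n.+1}) : (Y \in indep one_extension) =
  (unemb Y \in indep P) && ((new_point n \in Y) ==> new_free (unemb Y)).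
Proof. by rewrite [LHS]inE. Qed.

Lemma rk_new_free Y : new_free Y -> rk P Y < rk P (ground P).
Proof.
by move=> /new_freeP[H [/hyperplaneP[_ <- _] _ sY]]; rewrite ltnS; apply: rkS.
Qed.

Lemma rk_one_extension_emb X : rk one_extension (emb X) = rk P X.
Proof.
by apply: rk_emb => Y; rewrite one_extension_indep unembK new_point_emb andbT.
Qed.

Lemma new_point_closure X : X \subset ground P ->
  (new_point n \in closure one_extension (emb X)) =
  ~~ [exists I in indep P, [&& I \subset X, #|I| == rk P X & new_free I]].
Proof.
move=> gX; rewrite [LHS]inE rk_one_extension_emb.
have -> : new_point n \in ground one_extension by rewrite /ground /= !inE eqxx.
rewrite andTb; apply/idP/idP => [e|/exists_inPn h].
  apply/exists_inP => -[I iI /and3P[sI /eqP cI oI]].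
  have : #|new_point n |: emb I| <= rk one_extension (new_point n |: emb X).
    apply: indep_le_rk; last by rewrite setUS // embS.
    by rewrite one_extension_indep unembU1 unembK iI oI implybT.
  by rewrite (eqP e) cardsU1 new_point_emb card_emb cI ltnn.
rewrite eqn_leq -{2}rk_one_extension_emb rkS ?subsetUr // andbT.
have [I [iI sI <-]] := rk_witness one_extension (new_point n |: emb X).
have sX : unemb I \subset X by have := unembS sI; rewrite unembU1 unembK.
move: iI; rewrite one_extension_indep card_unemb => /andP[iI /implyP oI].
have := indep_le_rk iI sX; case: (boolP (_ \in I)) => pI; last by rewrite addn0.
by have := h _ iI; rewrite sX oI // andbT /=; rklia.
Qed.

(** A free set lies in a hyperplane and so is never a base. *)
Lemma one_extension_spanned : new_point n \in closure one_extension (emb (ground P)).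
Proof.
rewrite new_point_closure //; apply/exists_inP => -[I iI /and3P[_ /eqP cI /rk_new_free]].
by move: iI; rewrite indep_rk -cI => /eqP ->; rewrite ltnn.
Qed.

(** A basis of [H] lies in no other hyperplane, so its freeness is decided by [H] alone. *)
Lemma one_extension_hyperplane H : H \in hyperplanes P ->
  (new_point n \in closure one_extension (emb H)) = sel H.
Proof.
move=> hH; have /hyperplaneP[gH eH _] := hH; rewrite new_point_closure //.
apply/exists_inPn/idP => [h|sH I iI].
  apply/negPn/negP => nH; have [I [iI sI cI]] := rk_witness P H.
  by have := h I iI; rewrite sI cI eqxx /=; case/negP; apply/new_freeP; exists H.
apply/negP => /and3P[sI /eqP cI /new_freeP[H' [hH' sH' sI']]].
have rI : (rk P I).+1 = rk P (ground P) by move: iI; rewrite indep_rk => /eqP ->; rewrite cI.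
by have := hyperplane_eq hH hH' sI sI' rI => e; rewrite -e sH in sH'.
Qed.

End Crapo.

(** * The lift; linear classes of contractions *)

Section LiftTheory.
Variables (n : nat) (M : matroid 'I_n) (CL : {set {set 'I_n}}).
Implicit Types (X C : {set 'I_n}).
Hypothesis linCL : linear_class M CL.

Let G := ground M.

Lemma setDDground X : X \subset G -> G :\: (G :\: X) = X.
Proof. by move=> sX; rewrite setDDr setDv set0U; apply/setIidPr. Qed.

(** Being a modular pair is invariant under duality: in the corank formulas for the four sets the
    cardinalities cancel by inclusion and exclusion. *)
Lemma linear_class_dual (H1 H2 H : {set 'I_n}) :
  H1 \in hyperplanes (dual M) -> H2 \in hyperplanes (dual M) ->
  H \in hyperplanes (dual M) -> G :\: H1 \in CL -> G :\: H2 \in CL ->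
  rk (dual M) H1 + rk (dual M) H2 = rk (dual M) (H1 :|: H2) + rk (dual M) (H1 :&: H2) ->
  H1 :&: H2 \subset H -> G :\: H \in CL.
Proof.
move=> h1 h2 h c1 c2; have [_ lin] := linCL.
have s1 : H1 \subset G by case/hyperplaneP: h1.
have s2 : H2 \subset G by case/hyperplaneP: h2.
have s : H \subset G by case/hyperplaneP: h.
have sU : H1 :|: H2 \subset G by rewrite subUset s1.
have sI : H1 :&: H2 \subset G by apply: subset_trans s1; apply: subsetIl.
have := (rk_dual s1, rk_dual s2, rk_dual sU, rk_dual sI, cardsUI H1 H2).
rewrite -!/G setDUr setDIr => -[[[[]]]] e1 e2 eU eI cUI e sIH.
apply: lin c1 c2 _ _ _; first rklia.
  by rewrite -dual_hyperplane ?subsetDl // setDDground.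
by rewrite -setDIr setDS.
Qed.

(** Crapo's extension excludes the default value of [pick]. From here on the lift is known only
    through the specification [is_extension]. *)
Lemma extended_lift_dual : exists2 D, extended_lift M CL = dual D &
  is_extension (dual M) CL D.
Proof.
rewrite /extended_lift; case: pickP => [D eD|/(_ (one_extension linear_class_dual))/negP[]].
  by exists D.
apply/and4P; split.
- by [].
- by apply/forallP => X; rewrite one_extension_indep unembK new_point_emb andbT.
- exact: one_extension_spanned.
- by apply/forall_inP => H hH; rewrite one_extension_hyperplane.
Qed.

Lemma ground_lift : ground (extended_lift M CL) = new_point n |: emb G.
Proof. by have [D -> /and4P[/eqP e _ _ _]] := extended_lift_dual; rewrite -e. Qed.

(** This is [N / p = M], dual to the fact that deleting [p] from the extension gives back the dual
    of [M]. That [p] is spanned in the extension means that it is not a loop of the lift. *)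
Lemma indep_lift_new X :
  (new_point n |: emb X \in indep (extended_lift M CL)) = (X \in indep M).
Proof.
have [D eN /and4P[/eqP eG /forallP eI pD _]] := extended_lift_dual.
have sub : (new_point n |: emb X \subset ground (dual D)) = (X \subset G).
  rewrite ground_dual eG ground_dual; apply/idP/idP => [|sX]; last by rewrite setUS // embS.
  by move=> /unembS; rewrite !unembU1 !unembK.
have [sX|nX] := boolP (X \subset G); last first.
  apply/idP/idP => [|/indep_ground]; last by rewrite -/G (negPf nX).
  by rewrite eN => /indep_ground; rewrite sub (negPf nX).
have rD Y : rk D (emb Y) = rk (dual M) Y by apply: rk_emb => Z; apply/eqP.
have sXD : new_point n |: emb X \subset ground D by rewrite -ground_dual sub.
rewrite eN !indep_rk cardsU1 new_point_emb card_emb.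
have := rk_dual sXD; rewrite cardsU1 new_point_emb card_emb.
have -> : ground D :\: (new_point n |: emb X) = emb (G :\: X).
  rewrite eG ground_dual; apply: setP_new; first by rewrite new_point_emb !inE eqxx.
  by apply/setP => i; rewrite !inE !mem_emb lift_neq_new !inE.
move: pD; rewrite inE => /andP[_ /eqP]; rewrite -eG rD.
rewrite ground_dual rD.
have := rk_dual (subsetDl G X); rewrite setDDground //.
have := rk_dual (subxx G); rewrite setDv rk0 -/G.
have := cardsID X G; rewrite (setIidPr sX).
rklia.
Qed.

(** In the extension the complement of [emb C] is the hyperplane [G :\: C] together with [p]. By the
    corank formula, [emb C] is independent exactly when [p] raises the rank of that hyperplane. *)
Lemma indep_lift_circuit C : C \in circuits M ->
  (emb C \in indep (extended_lift M CL)) = (C \notin CL).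
Proof.
move=> cC; have sC := circuit_ground cC.
have [D eN /and4P[/eqP eG /forallP eI pD /forall_inP hD]] := extended_lift_dual.
have rD Y : rk D (emb Y) = rk (dual M) Y by apply: rk_emb => Z; apply/eqP.
have hH : G :\: C \in hyperplanes (dual M) by rewrite dual_hyperplane.
have := eqP (hD _ hH); rewrite ground_dual setDDground // => <-.
have sCD : emb C \subset ground D.
  by rewrite eG; apply: subset_trans (subsetUr _ _); rewrite embS.
have := rk_dual sCD.
have -> : ground D :\: emb C = new_point n |: emb (G :\: C).
  rewrite eG ground_dual; apply: setP_new; first by rewrite !inE eqxx new_point_emb.
  by apply/setP => i; rewrite !inE !mem_emb lift_neq_new !inE.
move: pD; rewrite inE => /andP[_ /eqP]; rewrite -eG ground_dual rD.
rewrite indep_rk eN card_emb.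
have -> : (new_point n \in closure D (emb (G :\: C))) =
    (rk D (new_point n |: emb (G :\: C)) == rk D (emb (G :\: C))).
  by rewrite inE eG !inE eqxx.
rewrite rD; have := rkU1_le D (emb (G :\: C)) (new_point n); rewrite rD.
have := rkS D (subsetUr [set new_point n] (emb (G :\: C))); rewrite rD.
have /hyperplaneP[_ + _] := hH; rewrite ground_dual -/G.
rklia.
Qed.

End LiftTheory.

(** * Two-element circuits and exchange of parallel elements *)

Section Parallel.
Variable T : finType.
Implicit Types (M : matroid T) (A C : {set T}) (x y : T) (CL : {set {set T}}).

Lemma circuit2_rk M x y : x != y -> [set x; y] \in circuits M ->
  [/\ [set x] \in indep M, [set y] \in indep M & rk M [set x; y] = 1].
Proof.
move=> ne c; have /circuitP[_ + _] := c; rewrite cards2 ne => -[e]; split=> //.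
  by apply: circuit_proper c _; rewrite properE subsetUl subUset !sub1set !inE eqxx eq_sym.
by apply: circuit_proper c _; rewrite properE subsetUr subUset !sub1set !inE (negPf ne).
Qed.

Lemma parallel_rk M x y A : x != y -> [set x; y] \in circuits M ->
  rk M (x |: A) = rk M (y |: A).
Proof.
have aux u v : u != v -> [set u; v] \in circuits M -> rk M (u |: A) <= rk M (v |: A).
  move=> ne /(circuit2_rk ne)[iu iv e].
  have : rk M (u |: (v |: A)) = rk M (v |: A).
    apply: (@rkU1_mono _ M [set v]); first exact: subsetUl.
    by rewrite e; apply/esym/eqP; rewrite -singleton_rk.
  by move=> <-; apply: rkS; rewrite setUS // subsetUr.
move=> ne c; apply/eqP; rewrite eqn_leq !aux // 1?eq_sym //.
by rewrite setUC.
Qed.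

Lemma parallel_indep M x y A : x != y -> [set x; y] \in circuits M ->
  x \notin A -> y \notin A -> (x |: A \in indep M) = (y |: A \in indep M).
Proof. by move=> ne c xA yA; rewrite !indep_rk (parallel_rk A ne c) !cardsU1 xA yA. Qed.

Lemma parallel_circuit M x y C : x != y -> [set x; y] \in circuits M ->
  C \in circuits M -> y \in C -> x \notin C -> x |: C :\ y \in circuits M.
Proof.
move=> ne c cC yC xC; have /circuitP[gC eC hC] := cC.
have gx : x \in ground M by apply: (subsetP (circuit_ground c)); rewrite !inE eqxx.
have cD := cardsD1 y C; rewrite yC in cD.
have r : rk M (x |: C :\ y) = rk M C by rewrite (parallel_rk _ ne c) setD1K.
have nx : x \notin C :\ y by rewrite inE negb_and xC orbT.
apply/circuitP; split.
- by rewrite subUset sub1set gx (subset_trans (subsetDl _ _) gC).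
- by rewrite cardsU1 nx r; rklia.
move=> z; rewrite !inE r => /orP[/eqP->|/andP[zy zC]].
  by rewrite setU1K // hC.
have zx : z != x by apply: contraNneq xC => <-.
have -> : (x |: C :\ y) :\ z = x |: (C :\ z :\ y).
  by apply/setP => w; rewrite !inE; case: (eqVneq w x) => [->|]; rewrite ?(eq_sym x) ?zx //= andbCA.
by rewrite (parallel_rk _ ne c) setD1K ?hC // !inE eq_sym zy.
Qed.

Lemma linear_class_circuit M CL C : linear_class M CL -> C \in CL -> C \in circuits M.
Proof. by case=> /subsetP h _; apply: h. Qed.

(** The circuits [[set x; y]] and [C] form a modular pair: they meet in [y] alone, and [x] adds
    nothing to the rank of [C]. *)
Lemma parallel_linear M CL x y C : linear_class M CL -> x != y -> [set x; y] \in CL ->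
  C \in CL -> y \in C -> x \notin C -> x |: C :\ y \in CL.
Proof.
move=> lin ne c2 cC yC xC; have := lin => -[/subsetP sCL].
have cc := sCL _ c2; move=> /(_ [set x; y] C (x |: C :\ y) c2 cC); apply.
- have [_ iy ->] := circuit2_rk ne cc.
  have -> : [set x; y] :&: C = [set y].
    apply/setP => z; rewrite !inE; case: (eqVneq z x) => [->|] /=; first by rewrite (negPf ne) (negPf xC).
    by have [->|] := eqVneq z y; rewrite ?yC.
  rewrite -setUA (setUidPr (_ : [set y] \subset C)) ?sub1set //.
  have -> : rk M (x |: C) = rk M C by rewrite (parallel_rk _ ne cc) (setUidPr _) // sub1set.
  by move: iy; rewrite singleton_rk => /eqP ->; rewrite addnC.
- exact: parallel_circuit (sCL _ cC) yC xC.
by rewrite subUset !sub1set !inE eqxx (subset_trans (subsetDl _ _)) // subsetUr.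
Qed.

End Parallel.

(** * Circuits and linear classes of a contraction *)

Section ContractClass.
Variables (T : finType) (M : matroid T) (CL : {set {set T}}) (x : T).
Implicit Types (A C D : {set T}).
Hypothesis lin : linear_class M CL.
Hypothesis ix : [set x] \in indep M.

Lemma contracted_ground : x \in ground M.
Proof. by rewrite -sub1set indep_ground. Qed.

Lemma contract_circuit_mem C : C \in circuits M -> x \in C -> C :\ x \in circuits (contract M x).
Proof.
move=> /circuitP[gC eC hC] xC; have cD := cardsD1 x C; rewrite xC in cD.
apply/circuitP; split; first by rewrite ground_contract setSD.
  by have := rk_contract (C :\ x) ix; rewrite setD1K //; rklia.
move=> z /setD1P[zx zC].
have := rk_contract (C :\ x) ix; have := rk_contract (C :\ x :\ z) ix.
have -> : x |: (C :\ x :\ z) = C :\ z.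
  by rewrite setDDl (setUC [set x] [set z]) -setDDl setD1K // !inE eq_sym zx.
by rewrite hC // setD1K // ; rklia.
Qed.

Lemma contract_circuit_notin C : C \in circuits M -> x \notin closure M C ->
  C \in circuits (contract M x).
Proof.
move=> /circuitP[gC eC hC]; rewrite closureS ?contracted_ground // => /eqP rx.
have r := rk_contract C ix.
have xC : x \notin C by apply: contra_eqN rx => xC; rewrite (setUidPr _) ?sub1set //; rklia.
apply/circuitP; split; first by rewrite ground_contract subsetD1 gC xC.
  rklia.
move=> z zC; have := rk_contract (C :\ z) ix; have := rkS (contract M x) (subsetDl C [set z]).
have : rk M (z |: (x |: (C :\ z))) <= (rk M (x |: (C :\ z))).+1 by apply: rkU1_le.
suff : rk M (x |: C :\ z) <> rk M (C :\ z).
  have : rk M (C :\ z) <= rk M (x |: C :\ z) by apply/rkS/subsetUr.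
  have := rkU1_le M (C :\ z) x; rewrite hC //; rklia.
by move=> /(rkU1_mono (subsetDl C [set z])); rklia.
Qed.

(** The two cases are whether or not [D] spans [x] in [M]. *)
Lemma circuit_of_contract D : D \in circuits (contract M x) ->
  (x |: D \in circuits M) \/ (D \in circuits M /\ x \notin closure M D).
Proof.
move=> /circuitP[]; rewrite ground_contract subsetD1 => /andP[gD xD] eD hD.
have r A := rk_contract A ix.
have rD := r D.
have rz z : z \in D -> rk M (x |: (D :\ z)) = rk M (x |: D) by rewrite -!r => /hD ->.
have rDx := rkU1_le M D x; have rDxS : rk M D <= rk M (x |: D) by apply/rkS/subsetUr.
have rDc := rk_le_card M D.
have [e|/eqP ne] := eqVneq (rk M (x |: D)) (rk M D).
  left; apply/circuitP; split; rewrite ?subUset ?sub1set ?contracted_ground ?cardsU1 ?xD //; first by rklia.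
  move=> z; rewrite !inE => /orP[/eqP->|zD]; first by rewrite setU1K.
  have -> : (x |: D) :\ z = x |: D :\ z; last exact: rz.
  have zx : z != x by apply: contraNneq xD => <-.
  by apply/setP => w; rewrite !inE; case: (eqVneq w x) => [->|//]; rewrite eq_sym zx.
right; split; last by rewrite closureS ?contracted_ground //; rklia.
apply/circuitP; split => // [|z zD]; first by rklia.
have := rkU1_le M (D :\ z) x; rewrite rz //; have := rkS M (subsetDl D [set z]); rklia.
Qed.

(** A set that does not span [x] does not contain it, so both halves of the class can be written
    [C :\ x] and treated together. *)
Lemma contract_classP D : reflect
  (exists C, [/\ C \in CL, D = C :\ x & x \in C \/ x \notin closure M C])
  (D \in contract_class M CL x).
Proof.
apply: (iffP idP) => [|[C [cC -> h]]].
  rewrite inE => /orP[/imsetP[C]|].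
    by rewrite inE => /andP[cC xC] ->; exists C; split => //; left.
  rewrite inE => /andP[cC xC]; exists D; split => //; last by right.
  apply/esym/setDidPl; rewrite disjoint_sym disjoints1; apply: contra xC => xD.
  by rewrite inE contracted_ground /= (setUidPr _) ?eqxx ?sub1set.
rewrite in_setU; have [xC|xC] := boolP (x \in C).
  by apply/orP; left; apply/imsetP; exists C; rewrite // inE cC.
have -> : C :\ x = C by apply/setDidPl; rewrite disjoint_sym disjoints1.
by case: h xC => [->|h _] //; apply/orP; right; rewrite inE cC.
Qed.

Lemma contract_class_linear : linear_class (contract M x) (contract_class M CL x).
Proof.
have [/subsetP sCL cl] := lin; split.
  apply/subsetP => D /contract_classP[C [cC -> h]].
  have [xC|xC] := boolP (x \in C); first by apply: contract_circuit_mem (sCL _ cC) xC.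
  have -> : C :\ x = C by apply/setDidPl; rewrite disjoint_sym disjoints1.
  by case: h xC => [->|h _] //; apply: contract_circuit_notin => //; apply: sCL.
move=> D1 D2 D /contract_classP[C1 [cC1 -> h1]] /contract_classP[C2 [cC2 -> h2]].
have r A := rk_contract A ix.
have e1 : x |: C1 :\ x = x |: C1 by apply/setP => z; rewrite !inE; case: eqP.
have e2 : x |: C2 :\ x = x |: C2 by apply/setP => z; rewrite !inE; case: eqP.
have eU : x |: (C1 :\ x :|: C2 :\ x) = x |: (C1 :|: C2).
  by apply/setP => z; rewrite !inE; case: eqP.
have eI : x |: ((C1 :\ x) :&: (C2 :\ x)) = x |: (C1 :&: C2).
  by apply/setP => z; rewrite !inE; case: eqP.
move=> e cD sD.
have em : rk M (x |: C1) + rk M (x |: C2) = rk M (x |: (C1 :|: C2)) + rk M (x |: (C1 :&: C2)).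
  move: e (r (C1 :\ x)) (r (C2 :\ x)) (r (C1 :\ x :|: C2 :\ x)).
  by move: (r ((C1 :\ x) :&: (C2 :\ x))); rewrite eU eI e1 e2; rklia.
have rmem C : x \in C -> rk M (x |: C) = rk M C by move=> xC; rewrite (setUidPr _) // sub1set.
have rh C : C \in CL -> x \in C \/ x \notin closure M C ->
    x \in C /\ rk M (x |: C) = rk M C \/ x \notin C /\ rk M (x |: C) = (rk M C).+1.
  move=> cC [xC|]; first by left; rewrite rmem.
  rewrite closureS ?contracted_ground ?(circuit_ground (sCL _ cC)) // => /eqP e'; right; split=> //.
  by apply: contra_eqN e' => /rmem ->; rklia.
have sub C : rk M (x |: C) = (rk M C).+1 -> forall A, A \subset C -> rk M (x |: A) = (rk M A).+1.
  move=> eC A sA; have := rkU1_le M A x; have : rk M A <= rk M (x |: A) by apply/rkS/subsetUr.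
  by have := rkU1_mono (M := M) (x := x) sA; rklia.
have r1 := rh _ cC1 h1; have r2 := rh _ cC2 h2.
have sm := rk_submod M C1 C2.
have leU : rk M (C1 :|: C2) <= rk M (x |: (C1 :|: C2)) by apply/rkS/subsetUr.
have leI := rkU1_le M (C1 :&: C2) x.
have leI' : rk M (C1 :&: C2) <= rk M (x |: (C1 :&: C2)) by apply/rkS/subsetUr.
(* Modularity in [M / x] descends to [M]. If [x] lies in neither circuit, submodularity leaves room
   for only one outcome: the pair is modular and [x] is not spanned by the union. *)
have [mod xU] : rk M C1 + rk M C2 = rk M (C1 :|: C2) + rk M (C1 :&: C2) /\
    (x \in C1 :|: C2 \/ rk M (x |: (C1 :|: C2)) = (rk M (C1 :|: C2)).+1).
  rewrite inE; case: r1 => -[x1 r1].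
    have eU' : rk M (x |: (C1 :|: C2)) = rk M (C1 :|: C2) by rewrite rmem // inE x1.
    case: r2 => -[x2 r2].
      by rewrite x1; split; [rewrite !rmem ?inE ?x1 ?x2 // in em|left].
    have := sub _ r2 _ (subsetIr C1 C2); rewrite x1; split; [rklia|by left].
  have := sub _ r1 _ (subsetIl C1 C2); case: r2 => -[x2 r2].
    have eU' : rk M (x |: (C1 :|: C2)) = rk M (C1 :|: C2) by rewrite rmem // inE x2 orbT.
    by rewrite x2 orbT; split; [rklia|left].
  by have := rkU1_le M (C1 :|: C2) x; split; [rklia|right; rklia].
have sDU : D \subset C1 :|: C2.
  by apply: subset_trans sD _; rewrite -setDUl subsetDl.
have xD : x \notin D.
  by apply: contraTN (circuit_ground cD) => xD; apply/subsetPn; exists x; rewrite ?inE ?eqxx.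
have eD A : x \notin A -> A :\ x = A by move=> xA; apply/setDidPl; rewrite disjoint_sym disjoints1.
apply/contract_classP; case: (circuit_of_contract cD) => [cxD|[cD' ncl]].
  exists (x |: D); rewrite setU1K //; split => //; last by left; rewrite !inE eqxx.
  apply: (cl _ _ _ cC1 cC2 mod cxD); rewrite subUset sub1set sDU andbT.
  (* If the union does not span [x], neither does [D], contrary to [x |: D] being a circuit. *)
  case: xU => // xU; have := sub _ xU _ sDU.
  have /circuitP[_ + h] := cxD; have := h x; rewrite !inE eqxx setU1K // => /(_ isT); rklia.
exists D; split; [exact: cl cC1 cC2 mod cD' sDU|by rewrite eD|by right].
Qed.

End ContractClass.

(** * The exterior algebra *)

Local Open Scope ring_scope.

Section ProductSpan.
Variables (K : fieldType) (aT : falgType K) (rT : vectType K).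

(** The inclusions between ideals below are reduced by this lemma to a single generator [g] with one
    factor on each side. *)
Lemma memv_prod3_ind (A B : {vspace aT}) (s : seq aT) (f : {linear aT -> rT})
    (W : {vspace rT}) :
  (forall u g v, u \in A -> g \in s -> v \in B -> f (u * g * v) \in W) ->
  forall w, w \in (A * <<s>> * B)%VS -> f w \in W.
Proof.
move=> h; pose F := linfun f.
suff sub : (A * <<s>> * B <= F @^-1: W)%VS.
  by move=> w /(subvP sub); rewrite -memv_preim lfunE.
rewrite -prodvA; apply/prodvP => u x uA xB.
have : x \in ((F \o amull u) @^-1: W)%VS.
  move: x xB; apply/subvP/prodvP => g v gs vB.
  have : g \in ((F \o amull u \o amulr v) @^-1: W)%VS.
    move: g gs; apply/subvP/span_subvP => g gs.
    by rewrite -memv_preim !comp_lfunE !lfunE /= mulrA; apply: h.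
  by rewrite -!memv_preim !comp_lfunE !lfunE /=.
by rewrite -!memv_preim !comp_lfunE !lfunE /=.
Qed.

End ProductSpan.

Section Ideal.
Variables (K : fieldType) (aT : falgType K).
Implicit Type s : seq aT.

Definition ideal s : {vspace aT} := (fullv * <<s>> * fullv)%VS.

Lemma ideal_mull s u v : v \in ideal s -> u * v \in ideal s.
Proof.
move=> vI; have := memv_prod3_ind (f := amull u) (W := ideal s) _ vI.
rewrite /= lfunE; apply=> x g y _ gs _; rewrite /= lfunE /= !mulrA.
exact: (memv_mul (memv_mul (memvf _) (memv_span gs)) (memvf _)).
Qed.

Lemma ideal_mulr s u v : v \in ideal s -> v * u \in ideal s.
Proof.
move=> vI; have := memv_prod3_ind (f := amulr u) (W := ideal s) _ vI.
rewrite /= lfunE; apply=> x g y _ gs _; rewrite /= lfunE /= -(mulrA _ y u).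
exact: (memv_mul (memv_mul (memvf _) (memv_span gs)) (memvf _)).
Qed.

Lemma ideal_gen s g : g \in s -> g \in ideal s.
Proof.
move=> gs; rewrite -[g]mulr1 -[g]mul1r.
exact: (memv_mul (memv_mul (memvf _) (memv_span gs)) (memvf _)).
Qed.

End Ideal.

Section ExteriorTheory.
Variables (K : fieldType) (m : nat).
Implicit Types (u v w : exterior K m) (X Y Z : {set 'I_m}) (x y z : 'I_m).
Implicit Types (phi psi : 'I_m -> K).
Local Notation E := (exterior K m).
Local Notation e X := (ext_e K X).

Lemma ext_decomp u : u = \sum_X u X *: e X.
Proof.
apply/ffunP => Z; rewrite sum_ffunE (bigD1 Z) //= big1 => [|X nX].
  by rewrite !ffunE eqxx addr0 /GRing.scale /= mulr1.
by rewrite !ffunE eq_sym (negPf nX) scaler0.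
Qed.

Definition ext_lift (V : lmodType K) (f : {set 'I_m} -> V) (u : E) : V :=
  \sum_X u X *: f X.

Fact ext_lift_linear (V : lmodType K) (f : {set 'I_m} -> V) : linear (@ext_lift V f).
Proof.
move=> a u v; rewrite /ext_lift scaler_sumr -big_split; apply: eq_bigr => X _ /=.
by rewrite !ffunE scalerDl scalerA.
Qed.

HB.instance Definition _ (V : lmodType K) (f : {set 'I_m} -> V) :=
  GRing.isLinear.Build K E V _ (@ext_lift V f) (@ext_lift_linear V f).

Lemma ext_lift_e (V : lmodType K) (f : {set 'I_m} -> V) X : @ext_lift V f (e X) = f X.
Proof.
rewrite /ext_lift (bigD1 X) //= big1 => [|Y nY].
  by rewrite ffunE eqxx scale1r addr0.
by rewrite ffunE (negPf nY) scale0r.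
Qed.

Lemma ext_e0 : e (set0 : {set 'I_m}) = 1 :> E. Proof. by []. Qed.

(** The sign of moving [y] to the front of the word of [X], whereas [last_sign] moves it to the
    back. *)
Definition sgn (y : 'I_m) X : K := (-1) ^+ #|[set i in X | (i < y)%N]|.

Lemma sgnM y X : sgn y X * sgn y X = 1.
Proof. by rewrite /sgn -expr2 sqrr_sign. Qed.

Lemma ext_e1M y X : e [set y] * e X = if y \in X then 0 else sgn y X *: e (y |: X).
Proof. by rewrite ext_eM disjoints1 /inv big_set1; case: (y \in X). Qed.

Lemma ext_e_split y X : y \in X -> e X = sgn y X *: (e [set y] * e (X :\ y)).
Proof.
move=> yX; rewrite ext_e1M !inE eqxx /= setD1K // scalerA.
have -> : sgn y (X :\ y) = sgn y X; last by rewrite sgnM scale1r.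
rewrite /sgn; congr (_ ^+ #|pred_of_set _|); apply/setP => i; rewrite !inE.
by case: (eqVneq i y) => [->|//]; rewrite ltnn !andbF.
Qed.

Lemma ext_ind (P : E -> Prop) :
  (forall a u v, P u -> P v -> P (a *: u + v)) -> (forall X, P (e X)) -> forall u, P u.
Proof.
move=> lin Pe u.
have P0 : P 0 by have := lin (-1) _ _ (Pe set0) (Pe set0); rewrite scaleN1r addNr.
rewrite [u]ext_decomp; apply: big_ind => // [v w Pv Pw|X _].
  by have := lin 1 _ _ Pv Pw; rewrite scale1r.
by have := lin (u X) _ _ (Pe X) P0; rewrite addr0.
Qed.

(** Identities between contractions and gradings then need to be checked only at 1 and under left
    multiplication by a generator. *)
Lemma ext_mul_ind (P : E -> Prop) :
  (forall a u v, P u -> P v -> P (a *: u + v)) -> P 1 ->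
  (forall y u, P u -> P (e [set y] * u)) -> forall u, P u.
Proof.
move=> lin P1 Pm; apply: ext_ind => // X; rewrite ext_eE.
by elim: (enum X) => [|y s IH]; rewrite ?big_nil // big_cons; apply: Pm.
Qed.

(** The interior product with the linear form [e_y |-> phi y]. *)
Definition contraction phi : E -> E :=
  ext_lift (fun X => \sum_(y in X) (phi y * sgn y X) *: e (X :\ y)).
HB.instance Definition _ phi := GRing.Linear.on (contraction phi).

Lemma contractionP phi a u v : contraction phi (a *: u + v) = a *: contraction phi u + contraction phi v.
Proof. exact: linearP. Qed.

Lemma contraction_e phi X : contraction phi (e X) = \sum_(y in X) (phi y * sgn y X) *: e (X :\ y).
Proof. exact: ext_lift_e. Qed.

Lemma contraction1 phi : contraction phi 1 = 0.
Proof. by rewrite -ext_e0 contraction_e big_set0. Qed.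

(** The sign bookkeeping of the interior product is concentrated here; anticommutation, square zero
    and the Leibniz rule follow formally. *)
Lemma contraction_mul1 phi y u : contraction phi (e [set y] * u) = phi y *: u - e [set y] * contraction phi u.
Proof.
move: u; apply: ext_ind => [a u v hu hv|X].
  rewrite mulrDr -scalerAr !contractionP hu hv mulrDr scalerBr -scalerAr scalerDr !scalerA.
  by rewrite (mulrC a) opprD addrACA.
rewrite ext_e1M contraction_e mulr_sumr; case: ifPn => yX.
  rewrite linear0 (bigD1 y) //= big1 => [|z /andP[zX zy]].
    by rewrite addr0 -scalerAr -scalerA -ext_e_split // subrr.
  by rewrite -scalerAr ext_e1M !inE eq_sym zy yX scaler0.
rewrite linearZ /= contraction_e (bigD1 y) ?inE ?eqxx //= setU1K //.
rewrite scalerDr scalerA mulrCA.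
have -> : sgn y (y |: X) = sgn y X.
  rewrite /sgn; congr (_ ^+ #|pred_of_set _|); apply/setP => i; rewrite !inE.
  by case: (eqVneq i y) => [->|//]; rewrite ltnn !andbF.
rewrite sgnM mulr1 scaler_sumr -sumrN; congr (_ + _).
rewrite (eq_bigl (fun z => z \in X)) => [|z]; last first.
  by rewrite !inE; case: (eqVneq z y) => [->|]; rewrite ?andbT //= (negPf yX).
apply: eq_bigr => z zX; have zy : z != y by apply: contraNneq yX => <-.
rewrite -scalerAr ext_e1M !inE (negPf yX) andbF !scalerA.
have -> : (y |: X) :\ z = y |: X :\ z.
  by apply/setP => i; rewrite !inE; case: (eqVneq i y) => [->|//]; rewrite eq_sym zy.
rewrite -scaleNr; congr (_ *: _); rewrite mulrCA -mulrA -mulrN; congr (_ * _).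
(* Adding or removing one point changes each count by one comparison of [y] with [z]. Exactly one of
   the two comparisons holds, which produces the minus sign. *)
have e1 : #|[set i in X | (i < y)%N]| = (#|[set i in X :\ z | (i < y)%N]| + (z < y))%N.
  rewrite (cardsD1 z) !inE zX addnC; congr (_ + _)%N.
  by apply: eq_card => i; rewrite !inE andbA.
have e2 : #|[set i in y |: X | (i < z)%N]| = (#|[set i in X | (i < z)%N]| + (y < z))%N.
  rewrite (cardsD1 y) !inE eqxx addnC; congr (_ + _)%N.
  apply: eq_card => i; rewrite !inE.
  by case: (eqVneq i y) => [->|]; rewrite //= (negPf yX).
rewrite /sgn e1 e2 -exprD -[RHS]mulN1r -exprD -exprS.
have : z <> y :> nat by move=> /val_inj; apply/eqP.
by move=> zNy; congr (_ ^+ _); move: zNy; case: (ltngtP z y) => //= _ _; rklia.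
Qed.

Lemma contraction_anti phi psi u :
  contraction phi (contraction psi u) = - contraction psi (contraction phi u).
Proof.
apply/eqP; rewrite -addr_eq0; apply/eqP.
move: u; apply: ext_mul_ind => [a u v hu hv||y u hu].
- by rewrite !contractionP /= addrACA -scalerDr hu hv scaler0 addr0.
- by rewrite !contraction1 !linear0 addr0.
rewrite !contraction_mul1 !linearB !linearZ /= !contraction_mul1.
rewrite !opprB addrACA [X in _ + X]addrACA -opprD (addrC (phi y *: _)) addrCA subrr addr0.
by rewrite -mulrDr hu mulr0.
Qed.

Lemma contraction_sq phi u : contraction phi (contraction phi u) = 0.
Proof.
move: u; apply: ext_mul_ind => [a u v hu hv||y u hu].
- by rewrite !contractionP /= hu hv scaler0 addr0.
- by rewrite contraction1 linear0.
by rewrite contraction_mul1 linearB linearZ /= contraction_mul1 hu mulr0 subr0 subrr.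
Qed.

(** The algebra automorphism equal to -1 on generators; it carries the sign in the Leibniz rule. *)
Definition grading : E -> E := ext_lift (fun X => (-1) ^+ #|X| *: e X).
HB.instance Definition _ := GRing.Linear.on grading.

Lemma gradingP a u v : grading (a *: u + v) = a *: grading u + grading v.
Proof. exact: linearP. Qed.

Lemma grading_e X : grading (e X) = (-1) ^+ #|X| *: e X.
Proof. exact: ext_lift_e. Qed.

Lemma grading1 : grading 1 = 1.
Proof. by rewrite -ext_e0 grading_e cards0 scale1r. Qed.

Lemma grading_mul1 y u : grading (e [set y] * u) = - (e [set y] * grading u).
Proof.
move: u; apply: ext_ind => [a u v hu hv|X].
  by rewrite mulrDr -scalerAr !gradingP hu hv /= mulrDr -scalerAr opprD scalerN.
rewrite ext_e1M grading_e -scalerAr ext_e1M.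
case: ifPn => yX; first by rewrite linear0 scaler0 oppr0.
by rewrite linearZ /= grading_e cardsU1 yX !scalerA -scaleNr exprS mulN1r mulrN mulrC.
Qed.

Lemma gradingM u v : grading (u * v) = grading u * grading v.
Proof.
move: u; apply: ext_mul_ind => [a u w hu hw||y u hu].
- by rewrite mulrDl -scalerAl !gradingP hu hw /= mulrDl -scalerAl.
- by rewrite mul1r grading1 mul1r.
by rewrite -mulrA !grading_mul1 hu mulrA mulNr.
Qed.

Lemma contractionM phi u v : contraction phi (u * v) = contraction phi u * v + grading u * contraction phi v.
Proof.
move: u; apply: ext_mul_ind => [a u w hu hw||y u hu].
- by rewrite mulrDl -scalerAl !contractionP gradingP hu hw !mulrDl -!scalerAl scalerDr addrACA.
- by rewrite mul1r contraction1 mul0r add0r grading1 mul1r.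
rewrite -mulrA !contraction_mul1 hu grading_mul1 mulrDr opprD mulrBl -scalerAl mulrA mulNr mulrA.
by rewrite addrA.
Qed.

(** The projection killing the generators outside [G]. Being multiplicative, it brings elements of
    an ideal of the whole algebra back to the algebra on [G]. *)
Definition restr (G : {set 'I_m}) : E -> E :=
  ext_lift (fun X => if X \subset G then e X else 0).
HB.instance Definition _ G := GRing.Linear.on (restr G).

Lemma restrP G a u v : restr G (a *: u + v) = a *: restr G u + restr G v.
Proof. exact: linearP. Qed.

Lemma restr_e G X : restr G (e X) = if X \subset G then e X else 0.
Proof. exact: ext_lift_e. Qed.

Lemma restrM G u v : restr G (u * v) = restr G u * restr G v.
Proof.
move: u; apply: ext_ind => [a u w hu hw|X].
  by rewrite mulrDl -scalerAl !restrP hu hw /= mulrDl -scalerAl.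
move: v; apply: ext_ind => [a v w hv hw|Y].
  by rewrite mulrDr -scalerAr !restrP hv hw /= mulrDr -scalerAr.
rewrite !restr_e ext_eM; case: ifPn => dXY; last first.
  rewrite linear0; case: ifP => _; rewrite ?mul0r //.
  by case: ifP => _; rewrite ?mulr0 // ext_eM (negPf dXY).
rewrite linearZ /= restr_e subUset.
case: (X \subset G); case: (Y \subset G);
  by rewrite ?mul0r ?mulr0 ?scaler0 // ext_eM dXY.
Qed.

(** The boundary counts positions from 1 and the contraction from 0, hence the minus sign. *)
Lemma boundaryE X : boundary K X = - contraction (fun=> 1) (e X).
Proof.
rewrite contraction_e /boundary -sumrN; apply: eq_bigr => x xX.
rewrite mul1r -scaleNr; congr (_ *: _).
have -> : [set i in X | (i <= x)%N] = x |: [set i in X | (i < x)%N].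
  apply/setP => i; rewrite !inE leq_eqVlt -[RHS]/((i == x) || _).
  by rewrite (inj_eq val_inj); case: (eqVneq i x) => [->|]; rewrite ?xX.
by rewrite cardsU1 !inE ltnn andbF add1n exprS mulN1r.
Qed.

End ExteriorTheory.

(** * A presentation of the bias algebra *)

Section Quotient.
Variables (K : fieldType) (vT : vectType K) (U V : {vspace vT}).

Fact quot_class_linear : linear (quot_class U V).
Proof. by move=> a u v; rewrite /quot_class linearP linearP. Qed.
HB.instance Definition _ :=
  GRing.isLinear.Build K vT (quot U V) _ (quot_class U V) quot_class_linear.

Lemma quot_class_val u : u \in U -> u - vsval (quot_class U V u) \in V.
Proof.
move=> uU; rewrite /quot_class vsprojK; last exact: memv_pi.
have uUV : u \in (U + V)%VS by apply: (subvP (addvSl U V)).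
by rewrite -{1}(addv_pi1_pi2 uUV) addrC addKr memv_pi2.
Qed.

Lemma quot_class0 u : u \in V -> quot_class U V u = 0.
Proof.
move=> uV; have uUV : u \in (U + V)%VS by apply: (subvP (addvSr U V)).
have := addv_pi1_pi2 uUV; rewrite addv_pi2_id // => /(canRL (addrK _)).
by rewrite subrr /quot_class => ->; rewrite linear0.
Qed.

Lemma quot_classK z : quot_class U V (vsval z) = z.
Proof.
by rewrite /quot_class /addv_pi1 daddv_pi_id ?capv_diff ?subvsP // vsvalK.
Qed.

End Quotient.

Section ExtOn.
Variables (K : fieldType) (m : nat) (G : {set 'I_m}).
Implicit Types (u v w : exterior K m) (X Y : {set 'I_m}).
Local Notation e X := (ext_e K X).

Lemma ext_on_e X : X \subset G -> e X \in ext_on K G.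
Proof. by move=> sX; apply/memv_span/map_f; rewrite mem_enum inE. Qed.

Lemma restr_on u : restr G u \in ext_on K G.
Proof.
apply: memv_suml => X _; apply: memvZ; case: ifP => [|_]; [exact: ext_on_e|exact: mem0v].
Qed.

Lemma restr_id u : u \in ext_on K G -> restr G u = u.
Proof.
suff sub : (ext_on K G <= lker (linfun (restr (K := K) G) - \1%VF)%R)%VS.
  move=> /(subvP sub); rewrite memv_ker !lfunE /= opp_lfunE id_lfunE lfunE /= subr_eq0.
  by move/eqP.
apply/span_subvP => _ /mapP[X + ->]; rewrite mem_enum inE => sX.
by rewrite memv_ker !lfunE /= opp_lfunE id_lfunE lfunE /= restr_e sX subrr.
Qed.

Lemma ext_onM u v : u \in ext_on K G -> v \in ext_on K G -> u * v \in ext_on K G.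
Proof. by move=> /restr_id <- /restr_id <-; rewrite -restrM restr_on. Qed.

Lemma ext_on1 : (1 : exterior K m) \in ext_on K G.
Proof. by rewrite -(ext_e0 K m) ext_on_e ?sub0set. Qed.

Lemma gen_ideal_gen (s : seq (exterior K m)) g : g \in s -> g \in gen_ideal G s.
Proof.
move=> gs; rewrite -[g]mulr1 -[g]mul1r.
exact: (memv_mul (memv_mul ext_on1 (memv_span gs)) ext_on1).
Qed.

Lemma gen_idealM (s : seq (exterior K m)) u w v : u \in ext_on K G -> v \in ext_on K G ->
  w \in gen_ideal G s -> u * w * v \in gen_ideal G s.
Proof.
move=> uG vG wI.
have := memv_prod3_ind (f := (amulr v \o amull u)%VF) (W := gen_ideal G s) _ wI.
rewrite /= comp_lfunE !lfunE; apply=> x g y xG gs yG.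
rewrite /= comp_lfunE !lfunE /= !mulrA -(mulrA _ y v).
exact: (memv_mul (memv_mul (ext_onM uG xG) (memv_span gs)) (ext_onM yG vG)).
Qed.

Lemma restr_contraction (phi : 'I_m -> K) X : X \subset G ->
  restr G (contraction phi (e X)) = contraction phi (e X).
Proof.
move=> sX; rewrite contraction_e linear_sum; apply: eq_bigr => y yX.
by rewrite linearZ /= restr_e (subset_trans (subsetDl _ _) sX).
Qed.

End ExtOn.

Section IdealExt.
Variables (K : fieldType) (m : nat).
Implicit Types (X Y : {set 'I_m}) (s : seq (exterior K m)).
Local Notation e X := (ext_e K X).

Lemma ext_e_sub X Y : X \subset Y ->
  e Y = (-1) ^+ inv X (Y :\: X) *: (e X * e (Y :\: X)).
Proof.
move=> sXY; rewrite ext_eM disjoint_sym disjoints_subset setDE subsetIr.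
have -> : X :|: Y :&: ~: X = Y by rewrite -setDE -{1}(setIidPr sXY) setID.
by rewrite scalerA -expr2 sqrr_sign scale1r.
Qed.

Lemma ideal_ext_sub s X Y : X \subset Y -> e X \in ideal s -> e Y \in ideal s.
Proof. by move=> /ext_e_sub -> eX; apply/memvZ/ideal_mulr. Qed.

Lemma boundary_cons y X : y \notin X ->
  boundary K (y |: X) = - sgn K y (y |: X) *: (e X - e [set y] * contraction (fun=> 1) (e X)).
Proof.
move=> yX; rewrite boundaryE (@ext_e_split _ _ y) ?setU11 // setU1K //.
by rewrite linearZ /= contraction_mul1 scale1r scaleNr.
Qed.

End IdealExt.

Section BiasIdeal.
Variables (K : fieldType) (n : nat).
Implicit Types (M : matroid 'I_n) (CL : {set {set 'I_n}}) (X C I : {set 'I_n}).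
Local Notation E := (exterior K n.+1).
Local Notation e X := (ext_e K X).

(* Killing e_p turns a relation [boundary (p |: C)] of the lift into e_C, which
   leaves the following relations; generators outside the ground set of M are
   killed too, so that the ideals of M and of M / x live in the same algebra. *)
Definition bias_gens M CL : seq E :=
  [seq e [set z] | z <- enum (~: emb (ground M))] ++
  [seq e (emb C) | C <- enum (circuits M)] ++
  [seq boundary K (emb C) | C <- enum [set C in CL | (1 < #|C|)%N]].

Definition bias_ideal M CL : {vspace E} := ideal (bias_gens M CL).

Lemma bias_gensP M CL g : g \in bias_gens M CL ->
  [\/ exists2 z, z \notin emb (ground M) & g = e [set z],
      exists2 C, C \in circuits M & g = e (emb C) |
      exists C, [/\ C \in CL, (1 < #|C|)%N & g = boundary K (emb C)]].
Proof.
rewrite !mem_cat => /or3P[] /mapP[C]; rewrite mem_enum !inE => h ->.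
- by constructor 1; exists C.
- by constructor 2; exists C; rewrite // inE.
- by case/andP: h => hC hc; constructor 3; exists C.
Qed.

Lemma bias_ideal_out M CL (Y : {set 'I_n.+1}) z : z \in Y -> z \notin emb (ground M) ->
  e Y \in bias_ideal M CL.
Proof.
move=> zY zG; apply: (@ideal_ext_sub _ _ _ [set z]); first by rewrite sub1set.
apply: ideal_gen; rewrite mem_cat; apply/orP; left.
by apply: map_f; rewrite mem_enum inE.
Qed.

Lemma bias_ideal_dep M CL X : X \notin indep M -> e (emb X) \in bias_ideal M CL.
Proof.
have [sX dX|/subsetPn[x xX xG] _] := boolP (X \subset ground M); last first.
  by apply: (@bias_ideal_out _ _ _ (lift ord_max x)); rewrite mem_emb.
have [C cC sC] := dep_circuit sX dX.
apply: (@ideal_ext_sub _ _ _ (emb C)); first by rewrite embS.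
apply: ideal_gen; rewrite !mem_cat; apply/orP; right; apply/orP; left.
by apply: map_f; rewrite mem_enum.
Qed.

Lemma bias_ideal_boundary M CL C : C \in CL -> (1 < #|C|)%N ->
  boundary K (emb C) \in bias_ideal M CL.
Proof.
move=> cC hC; apply: ideal_gen; rewrite !mem_cat; apply/orP; right; apply/orP; right.
by apply: map_f; rewrite mem_enum inE cC.
Qed.

Lemma boundary_in_ideal s (Y : {set 'I_n.+1}) :
  (forall z, z \in Y -> e (Y :\ z) \in ideal s) -> boundary K Y \in ideal s.
Proof. by move=> h; apply: memv_suml => z zY; apply: memvZ; apply: h. Qed.

End BiasIdeal.

Section Presentation.
Variables (K : fieldType) (n : nat) (M : matroid 'I_n) (CL : {set {set 'I_n}}).
Hypothesis lin : linear_class M CL.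
Implicit Types (X C I : {set 'I_n}).
Local Notation e X := (ext_e K X).
Local Notation p := (new_point n).

Local Notation N := (extended_lift M CL).
Local Notation G' := (p |: emb (ground M)).
Local Notation gens := (ext_e K [set p] :: os_gens K N).
Local Notation V := (gen_ideal (ground N) gens).
Local Notation J := (bias_ideal K M CL).

Lemma groundN : ground N = G'. Proof. exact: ground_lift. Qed.

Lemma p_notin_ground : p \notin emb (ground M).
Proof. by rewrite new_point_emb. Qed.

Lemma lift_dep X : emb X \notin indep N -> X \notin indep M.
Proof.
apply: contra => iX; have := indep_lift_new lin X; rewrite iX => iN.
by apply: indepS iN; apply: subsetUr.
Qed.

Lemma circuit_lift_in C : C \in circuits M -> C \in CL -> emb C \in circuits N.
Proof.
move=> cC hC; rewrite inE groundN (indep_lift_circuit lin cC) hC /=; apply/andP; split.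
  by apply: subset_trans (subsetUr _ _); rewrite embS circuit_ground.
apply/forall_inP => _ /embP[i iC ->].
apply: indepS (_ : p |: emb (C :\ i) \in _); first by rewrite embD emb1 subsetUr.
by rewrite indep_lift_new // circuit_indepD1.
Qed.

Lemma circuit_lift_notin C : C \in circuits M -> C \notin CL -> p |: emb C \in circuits N.
Proof.
move=> cC hC; rewrite inE groundN indep_lift_new // circuit_dep //=; apply/andP; split.
  by rewrite setUS // embS circuit_ground.
apply/forall_inP => z; rewrite in_setU1 => /orP[/eqP->|/embP[i iC ->]].
  by rewrite setU1K ?new_point_emb // indep_lift_circuit.
have -> : (p |: emb C) :\ lift ord_max i = p |: emb (C :\ i).
  apply: setP_new; first by rewrite !inE eqxx eq_sym lift_neq_new.
  by apply/setP => j; rewrite !inE !mem_emb lift_neq_new !inE (inj_eq (@lift_inj_max n)).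
by rewrite indep_lift_new // circuit_indepD1.
Qed.

(* A circuit of N avoiding p that is not a circuit of M has nullity 2 in M. *)
Lemma lift_circuit_nullity C c : emb C \in circuits N -> C \notin circuits M -> c \in C ->
  C :\ c \notin indep M.
Proof.
move=> cN nC cC; apply/negP => iCc.
have dC : C \notin indep M by apply/lift_dep/circuit_dep.
have gC : C \subset ground M.
  by have := circuit_ground cN; rewrite groundN => /unembS; rewrite unembU1 !unembK.
have [D cD sD] := dep_circuit gC dC.
have ltD : D \proper C by rewrite properEneq sD andbT; apply: contraNneq nC => <-.
have [d dC' dD] : exists2 d, d \in C & d \notin D by case/properP: ltD.
have iCd : emb (C :\ d) \in indep N.
  by rewrite embD emb1; apply: circuit_indepD1; rewrite ?mem_emb.
have ipC : p |: emb (C :\ c) \in indep N by rewrite indep_lift_new.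
have [|z] := indep_aug iCd ipC.
  rewrite cardsU1 new_point_emb !card_emb.
  by have := cardsD1 c C; have := cardsD1 d C; rewrite cC dC'; rklia.
rewrite in_setD in_setU1 => /andP[zd /orP[/eqP->|zc]].
  rewrite indep_lift_new // => iCd'.
  by have := circuit_dep cD; rewrite (indepS _ iCd') // subsetD1 sD.
case/imsetP: zc zd => i /setD1P[_ iC] ->; rewrite mem_emb in_setD1 iC andbT negbK => /eqP->.
by rewrite -emb1 -embU setD1K //; rewrite (negPf (circuit_dep cN)).
Qed.

Lemma gen_ideal_sub u : u \in V -> u \in J.
Proof.
move=> uV; have := memv_prod3_ind (f := idfun) (W := J) _ uV; apply=> {u uV} u g v _ + _.
move=> gs; apply/ideal_mulr/ideal_mull.
have eC (C0 : {set 'I_n.+1}) : C0 \in circuits N -> e C0 \in J.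
  move=> cC; have [pC|pC] := boolP (p \in C0).
    exact: bias_ideal_out pC p_notin_ground.
  rewrite -(emb_unemb pC); apply/bias_ideal_dep/lift_dep.
  by rewrite emb_unemb // circuit_dep.
move: gs; rewrite in_cons mem_cat => /or3P[/eqP->|/mapP[C +] ->|/mapP[C +] ->].
- by apply: bias_ideal_out p_notin_ground; rewrite inE.
- rewrite mem_enum inE => /andP[cC hC]; have [pC|pC] := boolP (p \in C).
    move: cC; rewrite -(emb_unembU pC); set X := unemb C => cC.
    rewrite boundary_cons ?new_point_emb //; apply/memvZ/memvB; last first.
      by apply/ideal_mulr/(@bias_ideal_out _ _ _ _ _ p); rewrite ?inE ?new_point_emb.
    by apply: bias_ideal_dep; have := circuit_dep cC; rewrite indep_lift_new.
  move: cC hC; rewrite -(emb_unemb pC) card_emb; set X := unemb C => cC hX.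
  have [cX|cX] := boolP (X \in circuits M).
    apply: bias_ideal_boundary => //; have := circuit_dep cC.
    by rewrite indep_lift_circuit // negbK.
  (* A circuit of the lift that is not one of [M] stays dependent in [M] after the loss of any
     element, so each term of its boundary already lies in [J]. *)
  apply: boundary_in_ideal => _ /embP[i iX ->].
  by rewrite -emb1 -embD; apply/bias_ideal_dep/lift_circuit_nullity.
- by rewrite mem_enum; apply: eC.
Qed.

Lemma restr_bias_ideal u : u \in J -> restr G' u \in V.
Proof.
move=> uJ; have := memv_prod3_ind (f := restr G') (W := V) _ uJ; apply=> {u uJ} u g v _ gs _.
have rG w : restr G' w \in ext_on K (ground N) by rewrite groundN restr_on.
rewrite /= !restrM; apply: gen_idealM (rG u) (rG v) _.
have pV : e [set p] \in V by apply: gen_ideal_gen; rewrite in_cons eqxx.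
have sG C : C \in circuits M -> emb C \subset G'.
  by move=> cC; apply: subset_trans (subsetUr _ _); rewrite embS circuit_ground.
case: (bias_gensP gs) => [[z zG ->]|[C cC ->]|[C [hC lt ->]]].
- rewrite restr_e sub1set !inE (negPf zG) orbF; case: eqP => [->//|_]; exact: mem0v.
- rewrite restr_e sG //; have [hC|hC] := boolP (C \in CL).
    apply: gen_ideal_gen; rewrite in_cons mem_cat; apply/orP; right; apply/orP; right.
    by apply: map_f; rewrite mem_enum circuit_lift_in.
  (* For [C] outside the class the circuit of the lift is [p |: emb C]; its boundary equals
     [e (emb C)] up to sign and a multiple of [e_p]. *)
  have bV : boundary K (p |: emb C) \in V.
    apply: gen_ideal_gen; rewrite in_cons mem_cat; apply/orP; right; apply/orP; left.
    apply: map_f; rewrite mem_enum inE circuit_lift_notin //= cardsU1 new_point_emb card_emb.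
    by rewrite ltnS card_gt0 (circuit_neq0 cC).
  have wV : e [set p] * contraction (fun=> 1) (e (emb C)) \in V.
    have wG : contraction (fun=> 1) (e (emb C)) \in ext_on K (ground N).
      by rewrite -(restr_contraction _ (sG _ cC)).
    by have := gen_idealM (ext_on1 _ _) wG pV; rewrite mul1r.
  move: bV; rewrite boundary_cons ?new_point_emb // => /(memvZ (- sgn K p (p |: emb C))).
  rewrite scalerA mulrNN sgnM scale1r => bV.
  by have := memvD bV wV; rewrite subrK.
- have cC := linear_class_circuit lin hC.
  rewrite boundaryE linearN /= restr_contraction ?sG // -boundaryE.
  apply: gen_ideal_gen; rewrite in_cons mem_cat; apply/orP; right; apply/orP; left.
  by apply: map_f; rewrite mem_enum inE circuit_lift_in //= card_emb.
Qed.

(** The projection to the bias algebra, extended to the whole exterior algebra so that [M] and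
    [M / x] share one domain of representatives. *)
Definition bias_class (u : exterior K n.+1) : bias K M CL := quot_class _ _ (restr G' u).

Lemma bias_class_is_linear : linear bias_class.
Proof. by move=> a u v; rewrite /bias_class restrP linearP. Qed.
HB.instance Definition _ :=
  GRing.isLinear.Build K _ (bias K M CL) _ bias_class bias_class_is_linear.

Lemma bias_class0 u : u \in J -> bias_class u = 0.
Proof. by move=> uJ; apply/quot_class0/restr_bias_ideal. Qed.

Lemma bias_class_e X : X \subset ground M -> bias_class (e (emb X)) = bias_e K M CL X.
Proof.
by move=> sX; rewrite /bias_class restr_e (subset_trans _ (subsetUr _ _)) // embS.
Qed.

Lemma bias_class_val u : u - vsval (bias_class u) \in J.
Proof.
have rJ : u - restr G' u \in J.
  move: u; apply: ext_ind => [a u v hu hv|X].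
    rewrite restrP opprD addrACA -scalerBr; exact: memvD (memvZ _ hu) hv.
  rewrite restr_e; case: ifP => [_|/negbT/subsetPn[z zX zG]].
    by rewrite subrr mem0v.
  rewrite subr0; apply: bias_ideal_out zX _; apply: contra zG => zG; by rewrite inE zG orbT.
rewrite -(subrKA (restr G' u)); apply: (memvD rJ); apply: gen_ideal_sub.
by apply: quot_class_val; rewrite groundN restr_on.
Qed.

Lemma bias_classK z : bias_class (vsval z) = z.
Proof.
rewrite /bias_class restr_id ?quot_classK // -groundN.
by apply: (subvP (diffvSl _ _)) (subvsP z).
Qed.

End Presentation.

(** * Residues *)

Lemma card_split_ord n (X : {set 'I_n}) y : y \in X ->
  #|X| = (#|[set i in X | (i < y)%N]| + #|[set i in X | (y < i)%N]|).+1.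
Proof.
move=> yX; rewrite (cardsD1 y) yX add1n; congr _.+1.
rewrite -(cardsID [set i : 'I_n | (i < y)%N]); congr (_ + _)%N; apply: eq_card => i.
  by rewrite !inE; case: (eqVneq i y) => [->|] //=; rewrite ltnn !andbF.
rewrite !inE -leqNgt leq_eqVlt -[(y == i :> nat)]/(y == i) (eq_sym y).
by case: (eqVneq i y) => [->|] //=; rewrite ?ltnn ?andbF // andbC.
Qed.

Section Grading.
Variables (K : fieldType) (m : nat).
Implicit Types (X : {set 'I_m}).

Lemma grading_boundary X : grading (boundary K X) = (-1) ^+ #|X|.-1 *: boundary K X.
Proof.
rewrite /boundary linear_sum scaler_sumr; apply: eq_bigr => x xX.
by rewrite linearZ /= grading_e !scalerA mulrC (cardsD1 x X) xX.
Qed.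

End Grading.

(** The generators are homogeneous, so the sign in the Leibniz rule only rescales them. *)
Lemma grading_bias_gens (K : fieldType) n (M : matroid 'I_n) CL g :
  g \in bias_gens K M CL -> exists c, grading g = c *: g.
Proof.
case/bias_gensP => [[z _ ->]|[C _ ->]|[C [_ _ ->]]];
  by eexists; rewrite ?grading_e ?grading_boundary.
Qed.

Section Residue.
Variables (K : fieldType) (n : nat) (M : matroid 'I_n) (CL : {set {set 'I_n}}) (x : 'I_n).
Hypothesis lin : linear_class M CL.
Hypothesis ix : [set x] \in indep M.
Implicit Types (X C I : {set 'I_n}) (y z : 'I_n).
Local Notation e X := (ext_e K X).
Local Notation J := (bias_ideal K M CL).
Local Notation J' := (bias_ideal K (contract M x) (contract_class M CL x)).

Definition parallel y := (y == x) || ([set x; y] \in CL).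

Definition parallel_form (w : 'I_n.+1) : K :=
  if unlift ord_max w is Some y then (parallel y)%:R else 0.

Lemma parallel_form_lift y : parallel_form (lift ord_max y) = (parallel y)%:R.
Proof. by rewrite /parallel_form liftK. Qed.

Lemma parallel_form_new : parallel_form (new_point n) = 0.
Proof. by rewrite /parallel_form unlift_none. Qed.

Lemma parallel_pair_circuit y : y != x -> parallel y -> [set x; y] \in circuits M.
Proof. by rewrite /parallel => /negPf -> /(linear_class_circuit lin). Qed.

Lemma parallel_ground y : parallel y -> y \in ground M.
Proof.
have [->|yx /(parallel_pair_circuit yx)/circuit_ground] := eqVneq y x.
  by rewrite -sub1set indep_ground.
by rewrite subUset !sub1set => /andP[].
Qed.

Lemma contract_dep X : x |: X \notin indep M -> X \notin indep (contract M x).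
Proof. by rewrite contract_indepE // => /negPf->; rewrite andbF. Qed.

Lemma contract_dep_mem X : x \in X -> X \notin indep (contract M x).
Proof. by rewrite contract_indepE // => ->. Qed.

(** Contracting [x] acts on [y] as contracting [y] itself would, since [x] may replace [y] without
    changing dependence. *)
Lemma contract_dep_parallel X y : X \notin indep M -> y \in X -> parallel y ->
  X :\ y \notin indep (contract M x).
Proof.
move=> dX yX py; have [yx|yx] := eqVneq y x.
  by apply: contract_dep; rewrite -yx setD1K.
have [xX|xX] := boolP (x \in X).
  by apply: contract_dep_mem; rewrite !inE eq_sym yx.
apply: contract_dep; have xy : x != y by rewrite eq_sym.
by rewrite (parallel_indep xy (parallel_pair_circuit yx py)) ?setD1K // !inE ?eqxx // negb_and xX orbT.
Qed.

Lemma parallel_class y : [set x; y] \in CL -> x != y.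
Proof.
move=> /(linear_class_circuit lin)/circuit_dep; apply: contraNneq => <-.
by rewrite setUid.
Qed.

(** By linearity [C] with [y] replaced by [x] is again in the class, and it has the same trace off
    [x]. The bound on the size excludes [C = [set x; y]]: a larger circuit cannot contain both. *)
Lemma contract_class_parallel C y : C \in CL -> (2 < #|C|)%N -> y \in C -> parallel y ->
  C :\ y \in contract_class M CL x.
Proof.
move=> hC c3 yC py; apply/contract_classP => //; have [yx|yx] := eqVneq y x.
  by rewrite -yx; exists C; split=> //; left.
have hxy : [set x; y] \in CL by move: py; rewrite /parallel (negPf yx).
have xy := parallel_class hxy.
have xC : x \notin C.
  apply/negP => xC; have := circuit_dep (linear_class_circuit lin hxy).
  rewrite (circuit_proper (linear_class_circuit lin hC)) // properEcard.
  by rewrite subUset !sub1set xC yC cards2 xy.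
have nx : x \notin C :\ y by rewrite !inE negb_and xC orbT.
exists (x |: C :\ y); rewrite setU1K //; split=> //; last by left; rewrite !inE eqxx.
exact: parallel_linear lin xy hxy hC yC xC.
Qed.

Lemma parallel_pair a b : [set a; b] \in CL -> a != b -> parallel a = parallel b.
Proof.
have aux c d : [set c; d] \in CL -> c != d -> parallel c -> parallel d.
  move=> hcd cd; rewrite /parallel => /orP[/eqP <-|hxc]; first by rewrite hcd orbT.
  have [//|dx] := eqVneq d x.
  have xc := parallel_class hxc.
  have xC : x \notin [set c; d] by rewrite !inE negb_or xc eq_sym.
  have := parallel_linear lin xc hxc hcd _ xC; rewrite !inE eqxx => /(_ isT).
  by rewrite setU1K ?inE.
move=> hab ab; apply/idP/idP; apply: aux => //; first by rewrite setUC.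
by rewrite eq_sym.
Qed.

Lemma contraction_emb X : contraction parallel_form (e (emb X)) =
  \sum_(y in X | parallel y) sgn K (lift ord_max y) (emb X) *: e (emb (X :\ y)).
Proof.
rewrite contraction_e big_imset /=; last by move=> ? ? _ _; apply: lift_inj.
rewrite [RHS]big_mkcondr; apply: eq_bigr => y yX.
rewrite parallel_form_lift embD emb1; case: (parallel y); first by rewrite mul1r.
by rewrite mul0r scale0r.
Qed.

(** If [C] does not span [x], it belongs to the contracted class. Otherwise every [C :\ y] is
    dependent in [M / x], and each term of the boundary is a relation. *)
Lemma boundary_contract_ideal C : C \in CL -> (1 < #|C|)%N -> boundary K (emb C) \in J'.
Proof.
move=> hC c2; have cC := linear_class_circuit lin hC.
have /circuitP[gC eC hDC] := cC.
have term y : C :\ y \notin indep (contract M x) -> e (emb C :\ lift ord_max y) \in J'.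
  by move=> d; rewrite -emb1 -embD; apply: bias_ideal_dep.
have [xC|xC] := boolP (x \in C).
  apply: boundary_in_ideal => _ /embP[y yC ->]; apply: term.
  have [->|yx] := eqVneq y x; first exact: circuit_dep (contract_circuit_mem ix cC xC).
  by apply: contract_dep_mem; rewrite !inE xC eq_sym yx.
have [xcl|xcl] := boolP (x \in closure M C); last first.
  apply: bias_ideal_boundary => //; apply/contract_classP => //; exists C; split => //; last by right.
  by apply/esym/setDidPl; rewrite disjoint_sym disjoints1.
apply: boundary_in_ideal => _ /embP[y yC ->]; apply/term/contract_dep.
rewrite dep_rk cardsU1 !inE negb_and xC orbT.
have : (rk M (x |: C :\ y) <= rk M (x |: C))%N by apply/rkS/setUS/subsetDl.
have := cardsD1 y C; rewrite yC; move: xcl; rewrite inE => /andP[_ /eqP ->].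
rklia.
Qed.

(** Anticommutation reduces the claim to the boundaries of the sets [C :\ y]. These are singletons
    when [C] has two elements, and give no relation; but then both elements of [C] have the same
    value under the form, so the contraction is a multiple of the boundary, whose square is zero. *)
Lemma contraction_boundary C : C \in CL -> (1 < #|C|)%N ->
  contraction parallel_form (boundary K (emb C)) \in J'.
Proof.
move=> hC c2; rewrite boundaryE linearN /= contraction_anti opprK.
have [c3|c3] := ltnP 2 #|C|.
  rewrite contraction_emb linear_sum; apply: memv_suml => y /andP[yC py].
  rewrite linearZ /= -[contraction _ _]opprK -boundaryE; apply/memvZ; rewrite memvN.
  apply: bias_ideal_boundary; first exact: contract_class_parallel.
  by move: c3; rewrite (cardsD1 y) yC.
have /cards2P[a [b [ab eC]]] : #|C| == 2 by rewrite eqn_leq c3.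
have -> : contraction parallel_form (e (emb C)) = (parallel a)%:R *: contraction (fun=> 1) (e (emb C)).
  rewrite !contraction_e scaler_sumr; apply: eq_bigr => _ /embP[y yC ->].
  rewrite mul1r parallel_form_lift scalerA; congr (_%:R * _ *: _).
  move: yC; rewrite eC !inE => /orP[/eqP->//|/eqP->]; rewrite (@parallel_pair a b) // -?eC //.
by rewrite linearZ /= contraction_sq scaler0 mem0v.
Qed.

Lemma contraction_bias_ideal u : u \in J -> contraction parallel_form u \in J'.
Proof.
move=> uJ; have := memv_prod3_ind (f := contraction parallel_form) (W := J') _ uJ.
apply=> {u uJ} u g v _ gs _ /=.
(* The Leibniz rule produces terms with [g] itself and terms with its contraction, so both must lie
   in [J']. *)
suff [gJ' gcJ'] : g \in J' /\ contraction parallel_form g \in J'.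
  have [c gc] := grading_bias_gens gs.
  rewrite contractionM contractionM gradingM gc mulrDl.
  apply: memvD; last by apply/ideal_mulr/ideal_mull/memvZ.
  by apply: memvD; apply: ideal_mulr; [apply: ideal_mull|apply: ideal_mull].
case: (bias_gensP gs) => [[z zG ->]|[C cC ->]|[C [hC c2 ->]]].
- have zG' : z \notin emb (ground (contract M x)).
    by apply: contra zG; apply/subsetP; rewrite embS ground_contract subsetDl.
  split; first by apply: bias_ideal_out zG'; rewrite inE.
  rewrite contraction_e big_set1.
  have -> : parallel_form z = 0; last by rewrite mul0r scale0r mem0v.
  case: (new_or_lift z) zG => [-> _|[y ->]]; first exact: parallel_form_new.
  by rewrite mem_emb parallel_form_lift; case: (boolP (parallel y)) => // /parallel_ground ->.
- have dC := circuit_dep cC; split.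
    apply: bias_ideal_dep; have [xC|xC] := boolP (x \in C); first exact: contract_dep_mem.
    by apply: contract_dep; apply: contra dC; apply/indepS/subsetUr.
  rewrite contraction_emb; apply: memv_suml => y /andP[yC py].
  by apply/memvZ/bias_ideal_dep/contract_dep_parallel.
by split; [apply: boundary_contract_ideal|apply: contraction_boundary].
Qed.

Lemma grading_bias_ideal u : u \in J -> grading u \in J.
Proof.
move=> uJ; have := memv_prod3_ind (f := @grading K n.+1) (W := J) _ uJ.
apply=> {u uJ} u g v _ gs _ /=; have [c gc] := grading_bias_gens gs.
rewrite !gradingM gc; apply/ideal_mulr/ideal_mull/memvZ; exact: ideal_gen.
Qed.

(** The contraction extracts a letter from the front of a word, [residue_e] from its back. For a
    word of k letters these differ by (-1)^(k-1), the eigenvalue of [- grading]. *)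
Definition residue_lift (z : bias K M CL) :
    bias K (contract M x) (contract_class M CL x) :=
  bias_class (contract M x) (contract_class M CL x)
    (contraction parallel_form (- grading (vsval z))).

Fact residue_lift_linear : linear residue_lift.
Proof.
move=> a u v; rewrite /residue_lift -[vsval _]/(a *: vsval u + vsval v).
by rewrite gradingP opprD -scalerN contractionP linearP.
Qed.
HB.instance Definition _ := GRing.isLinear.Build K (bias K M CL)
  (bias K (contract M x) (contract_class M CL x)) _ residue_lift residue_lift_linear.

Let lin' : linear_class (contract M x) (contract_class M CL x).
Proof. exact: contract_class_linear. Qed.

Lemma residue_lift_e X : X \in indep M -> residue_lift (bias_e K M CL X) =
  \sum_(y in X | parallel y) last_sign K X y *:
     bias_e K (contract M x) (contract_class M CL x) (X :\ y).
Proof.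
move=> iX; rewrite -bias_class_e ?indep_ground // /residue_lift.
set w := vsval _; have wJ : e (emb X) - w \in J by apply: bias_class_val.
have {wJ} := contraction_bias_ideal (grading_bias_ideal wJ).
rewrite linearB linearB /= => /(bias_class0 lin').
rewrite linearB /= => /eqP; rewrite subr_eq0 => /eqP eQ.
rewrite linearN linearN /= -eQ grading_e linearZ /= contraction_emb.
rewrite card_emb linearZ linear_sum /= -scaleNr scaler_sumr; apply: eq_bigr => y /andP[yX py].
rewrite linearZ /= scalerA bias_class_e //; last first.
  rewrite ground_contract subsetD1 (subset_trans (subsetDl _ _)) ?indep_ground //=.
  rewrite !inE negb_and negbK; have [//|xy] := eqVneq x y.
  apply/negP => xX; have yx : y != x by rewrite eq_sym.
  have := circuit_dep (parallel_pair_circuit yx py).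
  by rewrite (indepS _ iX) // subUset !sub1set xX.
congr (_ *: _); rewrite /sgn /last_sign.
have -> : #|[set i in emb X | (i < lift ord_max y)%N]| = #|[set i in X | (i < y)%N]|.
  rewrite -[RHS]card_emb; apply: eq_card => z; rewrite !inE.
  case: (new_or_lift z) => [->|[i ->]].
    by rewrite !new_point_emb.
  by rewrite !mem_emb inE !lift_max.
rewrite mulNr -exprD -mulN1r -exprS (card_split_ord yX) -[LHS]signr_odd -[RHS]signr_odd.
congr (_ ^+ nat_of_bool _); rewrite /= !oddD /=.
by do 2 case: (odd _).
Qed.

(** Two elements of the parallel class of [x] are dependent, so the sum over an independent [X] has
    at most one term; the rest compares signs. *)
Lemma residue_lift_correct X : X \in indep M ->
  residue_lift (bias_e K M CL X) = residue_e K M CL x X.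
Proof.
move=> iX; rewrite residue_lift_e // /residue_e.
have uniq_parallel y y' : y \in X -> y' \in X -> parallel y -> parallel y' -> y = y'.
  move=> yX yX' py py'; apply/eqP/negPn/negP => ne.
  have [yx|yx] := eqVneq y x.
    have yx' : y' != x by rewrite -yx eq_sym.
    have := circuit_dep (parallel_pair_circuit yx' py'); rewrite (indepS _ iX) //.
    by rewrite subUset !sub1set -yx yX.
  have [yx'|yx'] := eqVneq y' x.
    have := circuit_dep (parallel_pair_circuit yx py); rewrite (indepS _ iX) //.
    by rewrite subUset !sub1set -yx' yX yX'.
  have i2 : [set y'; y] \in indep M by apply: indepS iX; rewrite subUset !sub1set yX yX'.
  have xy' : x != y' by rewrite eq_sym.
  have xy : x != y by rewrite eq_sym.
  have := parallel_indep (A := [set y]) xy' (parallel_pair_circuit yx' py').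
  rewrite !inE eq_sym yx eq_sym ne -/(_ :|: _) i2 => /(_ isT isT).
  by rewrite (negPf (circuit_dep (parallel_pair_circuit yx py))).
have one y : y \in X -> parallel y -> forall F : 'I_n -> bias K (contract M x) (contract_class M CL x),
    \sum_(z in X | parallel z) F z = F y.
  move=> yX py F; rewrite (bigD1 y) ?yX //= big1 ?addr0 // => z /andP[/andP[zX pz]].
  by rewrite (uniq_parallel z y) // eqxx.
case: ifPn => xX; first by rewrite (one x) // /parallel eqxx.
case: pickP => [y /andP[yX hy]|none]; last first.
  rewrite big1 // => y /andP[yX]; rewrite /parallel => /orP[/eqP yx|hy].
    by rewrite -yx yX in xX.
  by have := none y; rewrite yX hy.
have py : parallel y by rewrite /parallel hy orbT.
rewrite (one y) // scalerA; congr (_ *: _).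
have xy : x != y by apply: contraNneq xX => ->.
rewrite /replace_sign /last_sign -exprD -[LHS]signr_odd -[RHS]signr_odd.
congr (_ ^+ nat_of_bool _).
have hv : x <> y :> nat by move=> /val_inj; apply/eqP.
(* For [x < y] the elements strictly between are counted twice on the right and cancel modulo 2; for
   [y < x] they account exactly for the difference of the two counts. *)
have [lt|lt|//] := ltngtP x y.
  have -> : #|[set i in x |: X :\ y | (x < i)%N]| =
      (#|[set i in X | (x < i < y)%N]| + #|[set i in X | (y < i)%N]|)%N.
    rewrite -(cardsID [set i : 'I_n | (i < y)%N]); congr (_ + _)%N; apply: eq_card => i.
      rewrite !inE; have := val_inj; case: (eqVneq i y) => [->|iy]; first by rewrite ltnn !andbF.
      by case: (eqVneq i x) => [->|ix' _] /=; rewrite ?ltnn ?andbF //= andbA.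
    rewrite !inE -leqNgt; case: (eqVneq i x) => [->|ix'] /=.
      by rewrite ltnn andbF (negPf xX).
    case: (eqVneq i y) => [->|iy] /=; first by rewrite ltnn andbF /= andbF.
    have : i <> y :> nat by move=> /val_inj; apply/eqP.
    by case: (i \in X); rewrite ?andbF //=; rklia.
  by rewrite !oddD addbA addbb.
have -> : #|[set i in x |: X :\ y | (x < i)%N]| = #|[set i in X | (x < i)%N]|.
  apply: eq_card => i; rewrite !inE.
  case: (eqVneq i x) => [->|ix'] /=; first by rewrite ltnn !andbF.
  by case: (eqVneq i y) => [->|] //=; rewrite ltnNge (ltnW lt) !andbF.
have -> : #|[set i in X | (y < i)%N]| =
    (#|[set i in X | (y < i < x)%N]| + #|[set i in X | (x < i)%N]|)%N.
  rewrite -(cardsID [set i : 'I_n | (i < x)%N]); congr (_ + _)%N; apply: eq_card => i.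
    by rewrite !inE andbA.
  rewrite !inE -leqNgt; case: (eqVneq i x) => [->|ix'] /=.
    by rewrite ltnn andbF (negPf xX) andbF.
  have : i <> x :> nat by move=> /val_inj; apply/eqP.
  by case: (i \in X); rewrite ?andbF //=; rklia.
by [].
Qed.

(** [residue_lift] witnesses the property from which [epsilon] chooses, so the chosen map has the
    prescribed values. *)
Lemma residue_bias_e X : X \in indep M ->
  residue K M CL x (bias_e K M CL X) = residue_e K M CL x X.
Proof.
move: X; rewrite /residue.
apply: (epsilon_spec (inhabits 0) (fun f : 'Hom(bias K M CL,
   bias K (contract M x) (contract_class M CL x)) =>
   forall I, I \in indep M -> f (bias_e K M CL I) = residue_e K M CL x I)).
by exists (linfun residue_lift) => X iX; rewrite lfunE /= residue_lift_correct.
Qed.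

End Residue.

(** * Dual bases *)

Section DualBases.
Variables (K : fieldType) (T : finType) (A : {set T}).

(** Stated for plain functions [phi i] so that it applies to the forms on [V] and also, with the
    roles exchanged, to evaluation at [e i] on the space of forms. *)
Lemma free_pairing (V : vectType K) (e : T -> V) (phi : T -> V -> K^o) :
  (forall i, linear (phi i)) ->
  {in A &, forall i j, phi i (e j) = (i == j)%:R} ->
  free [seq e i | i <- enum A].
Proof.
move=> phi_lin phiE; pose X : #|A|.-tuple V := map_tuple e (enum_tuple A).
suff /freeP : forall k, \sum_(i < #|A|) k i *: X`_i = 0 -> forall i, k i = 0 by [].
move=> k sum0 j; have XE (i : 'I_#|A|) : X`_i = e (enum_val i).
  by rewrite (nth_map (enum_val i)) -?cardE // -enum_val_nth.
have phi0 : phi (enum_val j) 0 = 0.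
  by have := phi_lin (enum_val j) (-1) 0 0; rewrite scaleN1r oppr0 addr0 scaleN1r addNr.
have phiD : {morph phi (enum_val j) : u v / u + v}.
  by move=> u v; have := phi_lin (enum_val j) 1 u v; rewrite !scale1r.
have := congr1 (phi (enum_val j)) sum0.
rewrite (big_morph _ phiD phi0) phi0 (bigD1 j) //= big1 => [|i ij].
  have := phi_lin (enum_val j) (k j) X`_j 0; rewrite !addr0 phi0 addr0 => ->.
  by rewrite XE phiE ?enum_valP // eqxx /GRing.scale /= mulr1.
have := phi_lin (enum_val j) (k i) X`_i 0; rewrite !addr0 phi0 addr0 => ->.
by rewrite XE phiE ?enum_valP // (inj_eq enum_val_inj) eq_sym (negPf ij) scaler0.
Qed.

Lemma dual_bases_of_span (V : vectType K) (e : T -> V) (f : T -> 'Hom(V, K^o)) :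
  (forall v, v \in <<[seq e i | i <- enum A]>>%VS) ->
  {in A &, forall i j, f i (e j) = (i == j)%:R} -> dual_bases A e f.
Proof.
move=> span_e fE; split=> //.
  apply/andP; split; first by apply/eqP/vspaceP => v; rewrite span_e memvf.
  by apply: (free_pairing (phi := fun i => f i)) => // i a u v; apply: linearP.
apply/andP; split; last first.
  apply: (@free_pairing _ f (fun i (g : 'Hom(V, K^o)) => g (e i) : K^o)) => [i a u v|i j iA jA].
    by rewrite add_lfunE scale_lfunE.
  by rewrite fE // eq_sym.
apply/eqP/vspaceP => g; rewrite memvf.
have -> : g = \sum_(i in A) g (e i) *: f i.
  apply/eqP; rewrite -subr_eq0; apply/eqP/lfunP => v; rewrite zero_lfunE.
  apply/eqP; rewrite -memv_ker; move: v (span_e v); apply/subvP/span_subvP.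
  move=> _ /mapP[j + ->]; rewrite mem_enum => jA.
  rewrite memv_ker add_lfunE opp_lfunE sum_lfunE (bigD1 j) //= big1 => [|i /andP[iA ij]].
    by rewrite addr0 scale_lfunE fE // eqxx /GRing.scale /= mulr1 subrr.
  by rewrite scale_lfunE fE // (negPf ij) scaler0.
by apply: memv_suml => i iA; apply/memvZ/memv_span/map_f; rewrite mem_enum.
Qed.

End DualBases.

(** * Broken circuits under contraction *)

Section BrokenCircuits.
Variable n : nat.
Implicit Types (M : matroid 'I_n) (CL : {set {set 'I_n}}) (C X I : {set 'I_n}) (c : 'I_n).

(** [Q] selects the minima taken into account: only part of the condition on [J] survives a
    contraction. *)
Definition broken_free CL (Q : pred 'I_n) X : Prop :=
  forall C c, C \in CL -> (1 < #|C|)%N -> c \in C -> (forall y, y \in C -> (c <= y)%N) ->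
    Q c -> ~~ (C :\ c \subset X).

Lemma NBC_P M CL X : reflect (X \in indep M /\ broken_free CL xpredT X) (X \in NBC M CL).
Proof.
rewrite inE; apply: (iffP andP) => [[iX /forall_inP h]|[iX h]]; split=> //.
  move=> C c hC c2 cC cmin _; apply: h; apply/imset2P; exists C c => //.
    by rewrite inE hC.
  by rewrite inE cC; apply/forall_inP.
apply/forall_inP => B /imset2P[C c]; rewrite !inE => /andP[hC c2] /andP[cC /forall_inP cmin] ->.
exact: h.
Qed.

Lemma NBC_indep M CL X : X \in NBC M CL -> X \in indep M.
Proof. by case/NBC_P. Qed.

(* Contracting x preserves the absence of broken circuits C \ min C with
   min C < x: such a circuit and its contraction have the same minimum. *)
Lemma broken_free_contract M CL (x : 'I_n) (Q Q' : pred 'I_n) X :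
  [set x] \in indep M -> x \in X ->
  (forall C c, C :\ c \subset X :\ x -> (1 < #|C|)%N -> c \in C -> (forall y, y \in C -> (c <= y)%N) ->
    Q' c -> Q c && (c < x)%N) ->
  broken_free CL Q X -> broken_free (contract_class M CL x) Q' (X :\ x).
Proof.
move=> ix xX QQ' bf _ c /(contract_classP _ ix)[C [hC -> _]] c2 cC cmin Q'c.
apply/negP => sub; have /andP[Qc cx] := QQ' _ _ sub c2 cC cmin Q'c.
have c2' : (1 < #|C|)%N by apply: leq_trans c2 (subset_leq_card _); apply: subsetDl.
have cC' : c \in C by case/setD1P: cC.
have cmin' y : y \in C -> (c <= y)%N.
  move=> yC; have [->|yx] := eqVneq y x; first exact: ltnW.
  by apply: cmin; rewrite !inE yx.
have /negP[] := bf C c hC c2' cC' cmin' Qc.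
apply/subsetP => y; rewrite !inE => /andP[yc yC].
have [->//|yx] := eqVneq y x.
by have := subsetP sub y; rewrite !inE yc yx yC => /(_ isT).
Qed.

End BrokenCircuits.

(** * Values of the iterated residues, and straightening *)

Section ResidueForms.
Variables (K : fieldType) (n : nat).
Implicit Types (M : matroid 'I_n) (CL : {set {set 'I_n}}) (C X I J : {set 'I_n}) (x y c : 'I_n).
Local Notation e X := (ext_e K X).

(** No relation has a constant term, as circuits are non-empty and boundaries are taken of sets with
    more than one element. Hence the coefficient read by [degree0] is independent of the
    representative. *)
Lemma restr0_bias_ideal M CL u : u \in bias_ideal K M CL -> restr set0 u = 0.
Proof.
move=> uJ; apply/eqP; rewrite -memv0.
have := memv_prod3_ind (f := restr set0) (W := 0%VS) _ uJ; apply=> {u uJ} u g v _ gs _ /=.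
suff g0 : restr set0 g = 0 by rewrite !restrM g0 mulr0 mul0r mem0v.
case: (bias_gensP gs) => [[z _ ->]|[C cC ->]|[C [_ c2 ->]]].
- by rewrite restr_e subset0 -cards_eq0 cards1.
- rewrite restr_e subset0 -(emb0 n) (inj_eq (@emb_inj n)).
  by rewrite (negPf (circuit_neq0 cC)).
rewrite /boundary linear_sum big1 // => z zC; rewrite linearZ /= restr_e subset0.
case: eqP => [e0|_]; rewrite ?scaler0 //.
by have := cardsD1 z (emb C); rewrite e0 cards0 zC card_emb => e1; rewrite e1 in c2.
Qed.

Lemma restr_coef m (G X : {set 'I_m}) (u : exterior K m) :
  restr G u X = if X \subset G then u X else 0.
Proof.
rewrite /restr /ext_lift sum_ffunE (bigD1 X) //= big1 => [|Y YX].
  rewrite addr0 !ffunE; case: ifP => _; rewrite ?ffunE ?eqxx ?scaler0 //.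
  by rewrite /GRing.scale /= mulr1.
by rewrite !ffunE; case: ifP => _; rewrite ?ffunE ?scaler0 // eq_sym (negPf YX) scaler0.
Qed.

Fact degree0_linear M CL :
  linear (fun z : bias K M CL => (vsval z : exterior K n.+1) set0 : K^o).
Proof. by move=> a u v; rewrite !ffunE. Qed.

Lemma degree0_e M CL X : linear_class M CL -> X \subset ground M ->
  degree0 K M CL (bias_e K M CL X) = (X == set0)%:R.
Proof.
move=> lin sX; rewrite /degree0.
pose g (z : bias K M CL) : K^o := (vsval z : exterior K n.+1) set0.
pose gL := GRing.isLinear.Build K (bias K M CL) K^o _ g (@degree0_linear M CL).
pose F : {linear bias K M CL -> K^o} := HB.pack g gL.
rewrite (lfunE F) /= /g -bias_class_e //.
have := restr0_bias_ideal (bias_class_val lin (e (emb X))).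
rewrite linearB /= => /eqP; rewrite subr_eq0 => /eqP/ffunP/(_ set0).
rewrite !restr_coef sub0set => <-.
by rewrite ffunE eq_sym -(emb0 n) (inj_eq (@emb_inj n)).
Qed.

Lemma residue_seq_cons M CL x s X : linear_class M CL -> [set x] \in indep M ->
  X \in indep M ->
  residue_seq K M CL (x :: s) (bias_e K M CL X) =
  residue_seq K (contract M x) (contract_class M CL x) s (residue_e K M CL x X).
Proof. by move=> lin ix iX; rewrite -residue_bias_e //; apply: comp_lfunE. Qed.

(** If the largest element [x] is not in [X], a nonzero value needs [y \in X] with [[set x; y]] in
    the class: for [x < y] the broken circuit [[set y]] lies in [X], for [y < x] the broken circuit
    [[set x]] lies in [I]. The condition on [X] is limited to minima not above some element of [s]
    because this is the part that passes to [X :\ x]. *)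
Lemma residue_seq_e s M CL X : linear_class M CL ->
  sorted (fun i j : 'I_n => (j < i)%N) s ->
  [set i in s] \in indep M -> broken_free CL xpredT [set i in s] ->
  X \in indep M -> broken_free CL (fun c => has (fun i : 'I_n => c <= i)%N s) X ->
  residue_seq K M CL s (bias_e K M CL X) = ([set i in s] == X)%:R.
Proof.
elim: s M CL X => [|x s IH] M CL X lin.
  move=> _ _ _ iX _; rewrite /= degree0_e ?indep_ground // eq_sym.
  by congr (_ == _)%:R; apply/setP => i; rewrite !inE.
rewrite [sorted _ _]/= path_sortedE => [/andP[/allP ltx srt]|i j k ij jk]; last exact: ltn_trans jk ij.
set I := [set i in x :: s] => iI bI iX bX.
have xI : x \in I by rewrite !inE eqxx.
have ix : [set x] \in indep M by apply: indepS iI; rewrite sub1set.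
have xs : x \notin s by apply/negP => /ltx; rewrite ltnn.
have eI : [set i in s] = I :\ x.
  by apply/setP => i; rewrite !inE; case: eqP => [->|//]; rewrite (negPf xs).
rewrite residue_seq_cons // /residue_e; case: ifPn => xX; last first.
  have IX : (I == X) = false by apply: contraNF xX => /eqP <-.
  rewrite IX; case: pickP => [y /andP[yX hxy]|_]; last by rewrite linear0.
  have xy : x != y by apply: contraNneq xX => ->.
  have c2 : (1 < #|[set x; y]|)%N by rewrite cards2 xy.
  have [lt|le] := ltnP x y.
    have min_x z : z \in [set x; y] -> (x <= z)%N.
      by rewrite !inE => /orP[] /eqP-> //; apply: ltnW.
    have /negP[] : ~~ ([set x; y] :\ x \subset X).
      by apply: bX min_x _ => //=; rewrite ?set21 ?leqnn.
    by rewrite setU1K ?sub1set // inE.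
  have min_y z : z \in [set x; y] -> (y <= z)%N by rewrite !inE => /orP[] /eqP->.
  have /negP[] : ~~ ([set x; y] :\ y \subset I).
    by apply: bI min_y _ => //=; rewrite set22.
  by rewrite setUC setU1K ?sub1set // inE eq_sym.
rewrite linearZ /= IH //.
- rewrite eI; have -> : (I :\ x == X :\ x) = (I == X).
    apply/eqP/eqP => [eIX|->//]; by rewrite -(setD1K xI) eIX setD1K.
  case: eqP => [eIX|_]; last by rewrite mulr0n scaler0.
  (* Here [X = I] and [x] is its largest element, so the sign is 1. *)
  rewrite /last_sign (_ : [set i in X | (x < i)%N] = set0) ?cards0 ?scale1r //.
  apply/setP => i; rewrite -eIX !inE; apply/negbTE/negP => /andP[/orP[/eqP->|/ltx lt] lt'].
    by rewrite ltnn in lt'.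
  by have := ltn_trans lt lt'; rewrite ltnn.
- exact: contract_class_linear.
- by rewrite eI contract_indepE // setD1K // iI !inE eqxx.
- rewrite eI; apply: broken_free_contract bI => // C c sub c2 cC cmin _ /=.
  (* The broken circuit has an element [d] in [s], and [d < x]; its minimum is therefore below [x]
     without further assumption. *)
  have [d dC dc] : exists2 d, d \in C & d != c.
    move: c2; rewrite (cardsD1 c) cC add1n ltnS card_gt0 => /set0Pn[d /setD1P[dc dC]].
    by exists d.
  apply: leq_ltn_trans (cmin d dC) _; apply: ltx.
  by have := subsetP sub d; rewrite -eI !inE dc dC => /(_ isT).
- by rewrite contract_indepE // setD1K // iX !inE eqxx.
apply: broken_free_contract bX => // C c _ _ _ _ /hasP[d ds cd].
have cx : (c < x)%N by apply: leq_ltn_trans cd (ltx d ds).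
by rewrite /= (ltnW cx) cx.
Qed.

Lemma residue_form_e M CL I J : linear_class M CL -> I \in NBC M CL -> J \in NBC M CL ->
  residue_form K M CL I (bias_e K M CL J) = (I == J)%:R.
Proof.
move=> lin /NBC_P[iI bI] /NBC_P[iJ bJ]; rewrite /residue_form.
have eI : [set i in rev (enum I)] = I.
  by apply/setP => i; rewrite inE mem_rev mem_enum.
rewrite residue_seq_e ?eI //; last by move=> C c hC c2 cC cmin _; apply: bJ.
rewrite rev_sorted /enum_mem -enumT sorted_filter; first by [].
  by move=> j i k; apply: ltn_trans.
by have := iota_ltn_sorted 0 n; rewrite -val_enum_ord sorted_map.
Qed.

(** Each straightening step replaces some [z] in [X] by the smaller [c], so the sum of the indices
    drops while the size is kept. [W] is arbitrary, so one argument serves a single degree and the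
    whole algebra. *)
Lemma bias_class_NBC M CL h (W : {vspace bias K M CL}) X : linear_class M CL ->
  (forall J, J \in NBC M CL -> #|J| = h -> bias_e K M CL J \in W) ->
  #|X| = h -> bias_class M CL (e (emb X)) \in W.
Proof.
move=> lin hW; have [k] := ubnP (\sum_(i in X) i)%N; elim: k X => // k IHk X ltk cX.
have [iX|dX] := boolP (X \in indep M); last first.
  by rewrite (bias_class0 lin) ?mem0v //; apply: bias_ideal_dep.
have [nX|] := boolP (X \in NBC M CL).
  by rewrite bias_class_e ?indep_ground //; apply: hW.
rewrite inE iX negb_forall_in => /exists_inP[_ /imset2P[C c + + ->]].
rewrite !inE negbK => /andP[hC c2] /andP[cC /forall_inP cmin] sub.
have cX' : c \notin X.
  apply/negP => cX'; have := circuit_dep (linear_class_circuit lin hC).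
  by rewrite (indepS _ iX) // -(setD1K cC) subUset sub1set cX'.
(* [A] completes the broken circuit to [X], so in the product of [e (emb A)] with the boundary of
   [C] the term at [c] is [e (emb X)] up to sign. *)
pose A := X :\: (C :\ c).
have dAC : [disjoint A & C].
  rewrite disjoints_subset; apply/subsetP => i; rewrite !inE negb_and negbK => /andP[/orP[/eqP->|//]].
  by rewrite (negPf cX').
have BJ : e (emb A) * boundary K (emb C) \in bias_ideal K M CL.
  by apply/ideal_mull/bias_ideal_boundary.
(* Only the invertibility of the coefficient at [c] matters, so the exponents of the signs are kept
   abstract. *)
have [s bE] : exists s : 'I_n -> nat, e (emb A) * boundary K (emb C) =
    \sum_(z in C) (-1) ^+ s z *: e (emb (A :|: C :\ z)).
  exists (fun z => #|[set i in emb C | (i <= lift ord_max z)%N]| + inv (emb A) (emb (C :\ z)))%N.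
  rewrite /boundary mulr_sumr big_imset /=; last by move=> ? ? _ _; apply: lift_inj.
  apply: eq_bigr => z zC; rewrite -scalerAr -emb1 -embD ext_eM exprD -scalerA embU.
  case: ifPn => //; rewrite -setI_eq0 => /negP[].
  rewrite -subset0 -(emb0 n); apply/subsetP => w; rewrite in_setI => /andP[/embP[i iA ->]].
  by rewrite !mem_emb !inE (disjointFr dAC iA) andbF.
move: BJ => /(bias_class0 lin); rewrite bE linear_sum (bigD1 c) //= linearZ /=.
have -> : A :|: C :\ c = X by rewrite /A setUC -{1}(setIidPr sub) setID.
move=> /eqP; rewrite addr_eq0 => /eqP eX.
have <- : (-1) ^+ s c *: ((-1) ^+ s c *: bias_class M CL (e (emb X))) = bias_class M CL (e (emb X)).
  by rewrite scalerA -expr2 sqrr_sign scale1r.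
rewrite eX; apply: memvZ; rewrite memvN; apply: memv_suml => z /andP[zC zc].
rewrite linearZ /=; apply: memvZ.
have zX : z \in X by apply: (subsetP sub); rewrite !inE zc.
have -> : A :|: C :\ z = c |: X :\ z.
  apply/setP => i; rewrite !inE; case: (eqVneq i c) => [->|ic] /=; first by rewrite cC eq_sym zc orbT.
  case: (eqVneq i z) => [->|iz] /=; first by rewrite zC.
  have := subsetP sub i; rewrite !inE ic /=; case: (i \in C) => //= [-> //|_]; by rewrite orbF.
have cXz : c \notin X :\ z by rewrite !inE negb_and cX' orbT.
apply: IHk; last by rewrite cardsU1 cXz -cX (cardsD1 z X) zX.
rewrite big_setU1 //=; move: ltk; rewrite (big_setD1 z) //=.
have : (c < z)%N by rewrite ltn_neqAle cmin // andbT eq_sym (inj_eq val_inj).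
rklia.
Qed.

Lemma bias_degree_NBC M CL h : linear_class M CL ->
  (bias_degree K M CL h <=
   <<[seq bias_e K M CL J | J <- enum [set I in NBC M CL | #|I| == h]]>>)%VS.
Proof.
move=> lin; apply/span_subvP => _ /mapP[X + ->]; rewrite mem_enum inE => /andP[iX /eqP cX].
rewrite -bias_class_e ?indep_ground //; apply: (@bias_class_NBC _ _ h) => // J nJ cJ.
by apply/memv_span/map_f; rewrite mem_enum inE nJ cJ eqxx.
Qed.

Lemma bias_NBC_span M CL (z : bias K M CL) : linear_class M CL ->
  z \in <<[seq bias_e K M CL J | J <- enum (NBC M CL)]>>%VS.
Proof.
move=> lin; rewrite -(bias_classK lin z); move: (vsval z); apply: ext_ind => [a u v hu hv|Y].
  by rewrite linearP; apply: memvD hv; apply: memvZ.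
have [pY|pY] := boolP (new_point n \in Y).
  rewrite (bias_class0 lin) ?mem0v //; apply: bias_ideal_out pY _.
  by rewrite new_point_emb.
rewrite -(emb_unemb pY); apply: (@bias_class_NBC _ _ #|unemb Y|) => // J nJ _.
by apply/memv_span/map_f; rewrite mem_enum.
Qed.

End ResidueForms.

Theorem theorem3p17 (n : nat) (K : fieldType) (M : matroid 'I_n)
    (CL : {set {set 'I_n}})
    (groundM : ground M = [set: 'I_n]) (linCL : linear_class M CL) :
  (forall h : nat,
     dual_bases [set I in NBC M CL | #|I| == h]
       (fun J => vsproj (bias_degree K M CL h) (bias_e K M CL J))
       (residue_form_on K M CL h)) /\
  dual_bases (NBC M CL) (bias_e K M CL) (residue_form K M CL).
Proof.
split=> [h|]; last first.
  apply: dual_bases_of_span => [z|I J nI nJ]; first exact: bias_NBC_span.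
  exact: residue_form_e.
have degJ J : J \in NBC M CL -> #|J| = h -> bias_e K M CL J \in bias_degree K M CL h.
  move=> nJ cJ; apply/memv_span/map_f; rewrite mem_enum inE cJ eqxx andbT.
  exact: NBC_indep nJ.
apply: dual_bases_of_span => [z|I J]; last first.
  move=> /setIdP[nI _] /setIdP[nJ /eqP cJ].
  by rewrite comp_lfunE lfunE /= vsprojK ?residue_form_e // degJ.
(* The family inside the component is the image under [vsproj] of the family in the bias algebra,
   and [z] is the projection of its own value; spanning is carried over by this linear map. *)
rewrite -(vsvalK z) -[vsproj _ _]lfunE.
have -> : [seq vsproj (bias_degree K M CL h) (bias_e K M CL J) |
      J <- enum [set I in NBC M CL | #|I| == h]] =
    map (linfun (vsproj (bias_degree K M CL h)))
      [seq bias_e K M CL J | J <- enum [set I in NBC M CL | #|I| == h]].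
  by rewrite -map_comp; apply: eq_map => J /=; rewrite lfunE.
rewrite -limg_span; apply: memv_img.
exact: (subvP (bias_degree_NBC K h linCL) _ (subvsP z)).
Qed.
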